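(* (Proto-Langlands formula) For any triple of parabolic subalgebras $\mathfrak p_1,\mathfrak p,\mathfrak p_2\in\mathcal P_{G,T}$ such that $\mathfrak p_1\subset\mathfrak p\supset\mathfrak p_2$, the following equality of morphisms $\mathfrak p_1\to\mathfrak p_2$ holds in the double incidence category $\mathcal Q$: $$\mathrm{Res}_{\mathfrak p}^{\mathfrak p_2}\circ\mathrm{Ind}_{\mathfrak p_1}^{\mathfrak p}=\mathrm{Ind}_{\mathfrak p_2\circ\mathfrak p_1}^{\mathfrak p_2}\circ\tau_{\mathfrak p_1\circ\mathfrak p_2}^{\mathfrak p_2\circ\mathfrak p_1}\circ\mathrm{Res}_{\mathfrak p_1}^{\mathfrak p_1\circ\mathfrak p_2},$$ where $\mathfrak p_1\circ\mathfrak p_2$ and $\mathfrak p_2\circ\mathfrak p_1$ denote Tits products.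
   Context: **Roots and cells.** $\mathbf k$ is a field of characteristic $0$; $G$ is a complex reductive algebraic group, $T$ a maximal torus, $\mathfrak g=\mathrm{Lie}(G)$, $\mathfrak h=\mathrm{Lie}(T)$, $\Delta\subset\mathfrak h^*$ the root system, $\mathfrak h_{\mathbb R}\subset\mathfrak h$ the real form containing the coroots, on which roots are real. $\mathcal P_{G,T}$ is the set of parabolic subalgebras of $\mathfrak g$ containing $\mathfrak h$. For $\mathfrak p\in\mathcal P_{G,T}$: $\Delta_{\mathfrak p}\subset\Delta$ is the set of roots occurring in $\mathfrak p$, $\mathfrak n_{\mathfrak p}$ its nilpotent radical, $\pi(\mathfrak p)$ its Levi subalgebra containing $\mathfrak h$; $C_{\mathfrak p}=\{x\in\mathfrak h_{\mathbb R}:\alpha(x)\ge0\ \forall\alpha\in\Delta_{\mathfrak p}\}$ with relative interior $C^\circ_{\mathfrak p}$. The $C^\circ_{\mathfrak p}$ are the faces of the root arrangement; $\mathfrak p\subset\mathfrak p'$ iff $C_{\mathfrak p'}\subset C_{\mathfrak p}$. $(\mathfrak p,\mathfrak p',\mathfrak p'')$ is collinear if there are points $a,b,c$ of $C^\circ_{\mathfrak p},C^\circ_{\mathfrak p'},C^\circ_{\mathfrak p''}$ with $b\in[a,c]$. **Tits product.** For $\mathfrak p,\mathfrak q\in\mathcal P_{G,T}$ let $\mathfrak l=\pi(\mathfrak p)\cap\pi(\mathfrak q)$ and let $H_{\mathfrak l}\subset\mathfrak h_{\mathbb R}$ be the common zero space of the roots of $\mathfrak l$. $\mathfrak p\circ\mathfrak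 q\in\mathcal P_{G,T}$ is the parabolic whose cell is the first chamber (face open in $H_{\mathfrak l}$) met by any segment going from a point of $C^\circ_{\mathfrak p}$ to a point of $C^\circ_{\mathfrak q}$; equivalently $\mathfrak p\circ\mathfrak q=(\mathfrak p\cap\mathfrak q)+\mathfrak n_{\mathfrak p}$. **The double incidence category $\mathcal Q$.** The $\mathbf k$-linear category with object set $\mathcal P_{G,T}$, generated by $\mathrm{Ind}_{\mathfrak p}^{\mathfrak p'}:\mathfrak p\to\mathfrak p'$ and $\mathrm{Res}_{\mathfrak p'}^{\mathfrak p}:\mathfrak p'\to\mathfrak p$ for $\mathfrak p\subset\mathfrak p'$, with relations: (2a) $\mathrm{Ind}_{\mathfrak p}^{\mathfrak p}=\mathrm{Res}_{\mathfrak p}^{\mathfrak p}=\mathrm{Id}$; (2b) for $\mathfrak p\subset\mathfrak p'\subset\mathfrak p''$, $\mathrm{Ind}_{\mathfrak p'}^{\mathfrak p''}\mathrm{Ind}_{\mathfrak p}^{\mathfrak p'}=\mathrm{Ind}_{\mathfrak p}^{\mathfrak p''}$, $\mathrm{Res}_{\mathfrak p'}^{\mathfrak p}\mathrm{Res}_{\mathfrak p''}^{\mathfrak p'}=\mathrm{Res}_{\mathfrak p''}^{\mathfrak p}$; (2c) $\mathrm{Res}_{\mathfrak p'}^{\mathfrak p}\mathrm{Ind}_{\mathfrak p}^{\mathfrak p'}=\mathrm{Id}_{\mathfrak p}$; and, with $\tau_{\mathfrak p}^{\mathfrak p'}:=\mathrm{Res}_{\mathfrak q}^{\mathfrak p'}\mathrm{Ind}_{\mathfrak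 p}^{\mathfrak q}$ for any $\mathfrak q\supset\mathfrak p,\mathfrak p'$ (independent of $\mathfrak q$): (2d) $\tau_{\mathfrak p}^{\mathfrak p''}=\tau_{\mathfrak p'}^{\mathfrak p''}\tau_{\mathfrak p}^{\mathfrak p'}$ for collinear $(\mathfrak p,\mathfrak p',\mathfrak p'')$; (2e) if $\mathfrak p'\subset\mathfrak p\supset\mathfrak p''$, $C_{\mathfrak p'}\supset C_{\mathfrak p}\subset C_{\mathfrak p''}$ are of codimension $1$ and $C_{\mathfrak p'},C_{\mathfrak p''}$ have the same linear span and lie on opposite sides of $C_{\mathfrak p}$ in it, then $\tau_{\mathfrak p'}^{\mathfrak p''}$ and $\tau_{\mathfrak p''}^{\mathfrak p'}$ are invertible. *)

(* Defs.v *)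
From HB Require Import structures.
From mathcomp Require Import all_boot all_order all_algebra generic_quotient.
From mathcomp Require Import boolp classical_sets reals.
From mathcomp Require Import complex.

Set Implicit Arguments.
Unset Strict Implicit.
Unset Printing Implicit Defensive.

Import Order.TTheory GRing.Theory Num.Theory.
Local Open Scope ring_scope.
Local Open Scope complex_scope.

Record lieAlgebra (F : fieldType) := LieAlgebra {
  lie_vect :> vectType F;
  bracket : lie_vect -> lie_vect -> lie_vect;
  bracketDl : forall c x y z,
    bracket (c *: x + y) z = c *: bracket x z + bracket y z;
  bracketDr : forall c x y z,
    bracket x (c *: y + z) = c *: bracket x y + bracket x z;
  bracketxx : forall x, bracket x x = 0;
  jacobi : forall x y z,
    bracket x (bracket y z) + bracket y (bracket z x)
      + bracket z (bracket x y) = 0 }.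

Section LieAlgebra.
Variables (F : fieldType) (g : lieAlgebra F).
Implicit Types (U V I J : {vspace g}) (x y : g).

Definition bracketv U V : {vspace g} :=
  <<[seq bracket x y | x <- vbasis U, y <- vbasis V]>>%VS.

Definition subalgebra U := (bracketv U U <= U)%VS.

Definition ideal U I := (I <= U)%VS && (bracketv U I <= I)%VS.

Definition derived_series U n := iter n (fun V => bracketv V V) U.

Definition solvable U := exists n, derived_series U n = 0%VS.

(* Every solvable ideal is central, i.e., the radical of g is its centre. *)
Definition reductive :=
  forall I, ideal fullv I -> solvable I -> bracketv fullv I = 0%VS.

Definition ad_diagonalizable x :=
  exists2 b : seq g, basis_of fullv b &
    forall v, v \in b -> exists c : F, bracket x v = c *: v.

(* Maximal abelian with semisimple adjoint action.  For g = Lie(G), with G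
   reductive over an algebraically closed field of characteristic 0, these are
   the Lie algebras of the maximal tori of G. *)
Definition cartan (h : {vspace g}) :=
  [/\ bracketv h h = 0%VS,
      forall V, bracketv V V = 0%VS -> (h <= V)%VS -> V = h
    & forall x, x \in h -> ad_diagonalizable x].

Definition borel U :=
  [/\ subalgebra U, solvable U &
      forall V, subalgebra V -> solvable V -> (U <= V)%VS -> V = U].

Definition parabolic U := subalgebra U /\ exists2 V, borel V & (V <= U)%VS.

Definition is_radical U I :=
  [/\ ideal U I, solvable I &
      forall J, ideal U J -> solvable J -> (J <= I)%VS].

Definition radical U : {vspace g} := xget 0%VS (is_radical U).

(* The nilpotent radical in the sense of Bourbaki (for a parabolic, the Lie
   algebra of the unipotent radical); unlike the largest nilpotent ideal, it
   does not contain the centre of g. *)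
Definition nilpotent_radical U : {vspace g} :=
  (bracketv U U :&: radical U)%VS.

Lemma bracketv_sub U V x y : x \in U -> y \in V -> bracket x y \in bracketv U V.
Proof.
move=> xU yV; rewrite (coord_vbasis xU) (coord_vbasis yV).
have brl (z : g) : linear (fun x : g => bracket x z).
  by move=> c a b; rewrite bracketDl.
have brr (z : g) : linear (bracket z) by move=> c a b; rewrite bracketDr.
pose Lr z : {linear g -> g} := HB.pack (bracket z)
  (GRing.isLinear.Build _ _ _ _ _ (brr z)).
pose Ll z : {linear g -> g} := HB.pack (fun x : g => bracket x z)
  (GRing.isLinear.Build _ _ _ _ _ (brl z)).
rewrite -[bracket _ _]/(Ll _ _) linear_sum; apply: rpred_sum => i _.
rewrite linearZ rpredZ //= -[bracket _ _]/(Lr _ _) linear_sum; apply: rpred_sum => j _.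
rewrite linearZ rpredZ //=; apply: memv_span; apply/allpairsP.
exists ((vbasis U)`_i, (vbasis V)`_j) => /=.
by rewrite !mem_nth ?size_tuple.
Qed.

Lemma bracketv_min U V (W : {vspace g}) :
  {in U & V, forall x y, bracket x y \in W} -> (bracketv U V <= W)%VS.
Proof.
move=> UVW; apply/span_subvP => _ /allpairsP[[x y] [/= xU yV ->]].
by apply: UVW; apply: vbasis_mem.
Qed.

Lemma bracketv0 : bracketv 0 0 = 0%VS.
Proof.
apply/eqP; rewrite -subv0; apply: bracketv_min => x y.
rewrite !memv0 => /eqP-> /eqP->; suff -> : bracket (0 : g) 0 = 0 by [].
exact: bracketxx.
Qed.

Lemma borel_exists : exists U, borel U.
Proof.
pose P n := `[< exists U, [/\ subalgebra U, solvable U & \dim U = n] >].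
have P0 : exists n, P n.
  exists 0%N; apply/asboolP; exists 0%VS; split.
  - by rewrite /subalgebra bracketv0.
  - by exists 0%N.
  - by rewrite dimv0.
have Pb n : P n -> (n <= \dim {:g})%N.
  by move=> /asboolP[U [_ _ <-]]; rewrite dimvS ?subvf.
case: (ex_maxnP P0 Pb) => n /asboolP[U [sU solU dU]] nmax.
exists U; split=> // V sV solV UV; apply/esym/eqP.
rewrite eqEdim UV dU; apply: nmax; apply/asboolP; by exists V.
Qed.

Lemma parabolic_fullv : parabolic fullv.
Proof.
split; first exact: subvf.
by have [U bU] := borel_exists; exists U; rewrite ?subvf.
Qed.

Lemma bracketvS U U' V V' :
  (U <= U')%VS -> (V <= V')%VS -> (bracketv U V <= bracketv U' V')%VS.
Proof.
move=> UU VV; apply: bracketv_min => x y xU yV.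
by apply: bracketv_sub; [apply: (subvP UU) | apply: (subvP VV)].
Qed.

Lemma derived_seriesS U V n :
  (U <= V)%VS -> (derived_series U n <= derived_series V n)%VS.
Proof. by move=> UV; elim: n => //= n IH; apply: bracketvS. Qed.

Lemma derived_seriesD U n m :
  derived_series U (n + m) = derived_series (derived_series U m) n.
Proof. exact: iterD. Qed.

Lemma bracketDlr x y z t : bracket (x + y : g) (z + t) =
  bracket x z + bracket x t + (bracket y z + bracket y t).
Proof.
have Dl (a b c : g) : bracket (a + b) c = bracket a c + bracket b c.
  by rewrite -[a]scale1r bracketDl !scale1r.
have Dr (a b c : g) : bracket a (b + c) = bracket a b + bracket a c.
  by rewrite -[b]scale1r bracketDr !scale1r.
by rewrite Dl !Dr.
Qed.

Lemma bracketC x y : bracket (x : g) y = - bracket y x.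
Proof.
apply/eqP; rewrite -addr_eq0; apply/eqP.
by have := bracketxx (x + y); rewrite bracketDlr !bracketxx add0r addr0.
Qed.

Lemma bracket0 x : bracket x 0 = 0.
Proof. by have := bracketDr (-1) x 0 0; rewrite !scaleN1r addr0 oppr0 addNr. Qed.

Lemma ideal_add U I J : ideal U I -> ideal U J -> ideal U (I + J)%VS.
Proof.
move=> /andP[IU UI] /andP[JU UJ]; apply/andP; split; first by rewrite subv_add IU.
apply: bracketv_min => x _ xU /memv_addP[y yI [z zJ ->]].
have -> : bracket x (y + z) = bracket x y + bracket x z.
  by rewrite -[y in LHS]scale1r bracketDr scale1r.
apply: memv_add; [apply: (subvP UI) | apply: (subvP UJ)];
  exact: bracketv_sub.
Qed.

Lemma solvable_add U I J :
  ideal U I -> ideal U J -> solvable I -> solvable J -> solvable (I + J)%VS.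
Proof.
move=> /andP[IU UI] /andP[JU UJ] [n In] [m Jm].
have DIJ l : (derived_series (I + J) l <= derived_series I l + J)%VS /\
             (derived_series I l <= I)%VS.
  elim: l => [|l [IH Il]] /=; first by split; apply: subvv.
  split; last first.
    exact: subv_trans (bracketvS (subv_trans Il IU) Il) UI.
  apply: (subv_trans (bracketvS IH IH)); apply: bracketv_min => u v.
  move=> /memv_addP[x xI [x' x'J ->]] /memv_addP[y yI [y' y'J ->]].
  have JP a b : a \in U -> b \in J -> bracket a b \in J.
    by move=> aU bJ; apply: (subvP UJ); apply: bracketv_sub.
  have inU a : a \in derived_series I l -> a \in U.
    by move=> aI; apply: (subvP IU); apply: (subvP Il).
  have inU' a : a \in J -> a \in U by apply: (subvP JU).
  rewrite bracketDlr -!addrA memv_add //; first exact: bracketv_sub.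
  rewrite !rpredD //; first by apply: JP => //; apply: inU.
    by rewrite bracketC rpredN; apply: JP => //; apply: inU.
  by apply: JP => //; apply: inU'.
exists (m + n)%N; apply/eqP; rewrite derived_seriesD -subv0 -Jm.
by apply: derived_seriesS; have [] := DIJ n; rewrite In add0v.
Qed.

Lemma radicalP U : is_radical U (radical U).
Proof.
apply: xgetPex.
pose P n := `[< exists I, [/\ ideal U I, solvable I & \dim I = n] >].
have P0 : exists n, P n.
  exists 0%N; apply/asboolP; exists 0%VS; split; last exact: dimv0.
    rewrite /ideal sub0v; apply: bracketv_min => x y xU; rewrite !memv0 => /eqP->.
    by rewrite bracket0.
  by exists 0%N.
have Pb n : P n -> (n <= \dim {:g})%N.
  by move=> /asboolP[I [_ _ <-]]; rewrite dimvS ?subvf.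
case: (ex_maxnP P0 Pb) => n /asboolP[I [idI solI dI]] nmax.
exists I; split=> // J idJ solJ.
have : (\dim (I + J)%VS <= \dim I)%N.
  rewrite dI; apply: nmax; apply/asboolP; exists (I + J)%VS; split=> //.
    exact: ideal_add.
  exact: solvable_add idI idJ solI solJ.
by rewrite (geq_leqif (dimv_leqif_sup (addvSl I J))) subv_add => /andP[].
Qed.

End LieAlgebra.

(* Convex geometry in a complex vector space V; the sets of interest lie in a
   real form of V. *)
Section RealGeometry.
Variables (R : realType) (V : vectType R[i]).
Implicit Types (S L M : set V) (x y v w : V).

Definition segment x y : set V :=
  [set z | exists2 t : R, 0 <= t <= 1 & z = (1 - t)%:C *: x + t%:C *: y].

Definition linear_hull S : set V :=
  [set x | exists n (c : 'I_n -> V) (t : 'I_n -> R),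
     (forall i, S (c i)) /\ x = \sum_i (t i)%:C *: c i].

Definition affine_hull S : set V :=
  [set x | exists n (c : 'I_n -> V) (t : 'I_n -> R),
     [/\ forall i, S (c i), \sum_i t i = 1 & x = \sum_i (t i)%:C *: c i]].

(* The interior of S within its affine hull, for the usual topology of V, given
   here by the sup norm in some coordinates. *)
Definition relative_interior S : set V :=
  [set x | S x /\ exists2 e : R, 0 < e &
     forall y, affine_hull S y ->
       (forall j, `|coord (vbasis fullv) j (y - x)| < e%:C) -> S y].

(* L and M are real linear subspaces. *)
Definition codim1 L M :=
  (M `<=` L)%classic /\ exists v, [/\ L v, ~ M v &
    forall x, L x -> exists2 w, M w & exists s : R, x = w + s%:C *: v].

(* S1 and S2 lie on opposite sides of the hyperplane M of the subspace that
   they span. *)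
Definition opposite_sides M S1 S2 :=
  exists v, [/\ ~ M v,
    forall x, S1 x ->
      exists2 w, M w & exists2 s : R, 0 <= s & x = w + s%:C *: v
  & forall x, S2 x ->
      exists2 w, M w & exists2 s : R, 0 <= s & x = w - s%:C *: v].

Definition real_form S :=
  [/\ S 0, forall x y, S x -> S y -> S (x + y),
      forall (s : R) x, S x -> S (s%:C *: x)
    & forall x, exists! ab : V * V,
        [/\ S ab.1, S ab.2 & x = ab.1 + 'i *: ab.2]].

End RealGeometry.

Section Roots.
Variables (R : realType) (g : lieAlgebra R[i]) (h : {vspace g}).

(* The dual space of h. *)
Definition weight := 'Hom(subvs_of h, R[i]^o).

Implicit Types (U : {vspace g}) (a : weight).

Definition weight_vector a (x : g) :=
  forall t : subvs_of h, bracket (vsval t) x = a t *: x.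

(* The nonzero weights of h in U, for U a subspace of g containing h. *)
Definition roots_in U : set weight :=
  [set a | a != 0 /\ exists x, [/\ x \in U, x != 0 & weight_vector a x]].

Definition is_coroot a (t : subvs_of h) :=
  [/\ roots_in fullv a, a t = 2 &
      exists x y, [/\ weight_vector a x, weight_vector (- a) y
                    & vsval t = bracket x y]].

(* On the centre of g these conditions leave some freedom: the usual choice for
   a maximal torus T is the real span of the cocharacters of T. *)
Definition root_real_form (hR : set (subvs_of h)) :=
  [/\ real_form hR,
      forall a t, is_coroot a t -> hR t
    & forall a t, roots_in fullv a -> hR t -> a t \is Num.real].

Structure parab := Parab {
  parab_val :> {vspace g};
  _ : `[< parabolic parab_val >] && (h <= parab_val)%VS }.

HB.instance Definition _ := [isSub for parab_val].
HB.instance Definition _ := [Choice of parab by <:].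

Lemma parab_fullP : `[< parabolic (fullv : {vspace g}) >] && (h <= fullv)%VS.
Proof. by rewrite subvf andbT; apply/asboolP/parabolic_fullv. Qed.

Definition parab_full : parab := Parab parab_fullP.

Lemma parab_sub_full (p : parab) : (p <= parab_full)%VS.
Proof. exact: subvf. Qed.

(* The default value p of insubd is never used when g is reductive and h is a
   Cartan subalgebra, since (p :&: q) + n_p is then parabolic. *)
Definition tits (p q : parab) : parab :=
  insubd p ((p :&: q) + nilpotent_radical p)%VS.

Lemma tits_sub (p q : parab) : (tits p q <= p)%VS.
Proof.
rewrite /tits; have -> : (tits p q : {vspace g}) = val (tits p q) by [].
rewrite val_insubd; case: ifP => _; last exact: subvv.
rewrite subv_add capvSl /nilpotent_radical.
apply: subv_trans (capvSl _ _) _.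
by have /andP[/asboolP[]] := valP p.
Qed.

Variable hR : set (subvs_of h).

Definition cone (p : parab) : set (subvs_of h) :=
  [set x | hR x /\ forall a, roots_in p a -> 0 <= a x].

Definition cell (p : parab) : set (subvs_of h) := relative_interior (cone p).

Definition collinear (p p' p'' : parab) :=
  exists x y z, [/\ cell p x, cell p' y, cell p'' z & segment x z y].

Definition opposite_across (p p' p'' : parab) :=
  let L := linear_hull (cone p) in
  let L' := linear_hull (cone p') in
  let L'' := linear_hull (cone p'') in
  [/\ (p' <= p)%VS /\ (p'' <= p)%VS, codim1 L' L, codim1 L'' L, L' = L''
    & opposite_sides L (cone p') (cone p'')].

End Roots.

Arguments parab_full {R g h}.

Record linCat (k : fieldType) := LinCat {
  obj :> Type;
  hom : obj -> obj -> lmodType k;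
  idm : forall p, hom p p;
  comp : forall p q r, hom q r -> hom p q -> hom p r;
  compA : forall p q r s (c : hom r s) (b : hom q r) (a : hom p q),
    comp c (comp b a) = comp (comp c b) a;
  compm1 : forall p q (a : hom p q), comp a (idm p) = a;
  comp1m : forall p q (a : hom p q), comp (idm q) a = a;
  compPl : forall p q r (c : k) (b b' : hom q r) (a : hom p q),
    comp (c *: b + b') a = c *: comp b a + comp b' a;
  compPr : forall p q r (c : k) (b : hom q r) (a a' : hom p q),
    comp b (c *: a + a') = c *: comp b a + comp b a' }.

Arguments comp {k l p q r}.
Notation "b \oQ a" := (comp b a) (at level 50, left associativity).

Section DoubleIncidence.
Variables (k : fieldType) (R : realType) (g : lieAlgebra R[i]).
Variables (h : {vspace g}) (hR : set (subvs_of h)).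
Local Notation parab := (parab h).
Implicit Types p q r s : parab.

(* Formal k-linear expressions in the generators.  The invertibility relation
   is imposed by adjoining formal inverses; as opposite_across p _ _ is
   symmetric, this inverts the transition morphisms in both directions. *)
Inductive term : parab -> parab -> Type :=
| tId p : term p p
| tComp p q r of term q r & term p q : term p r
| tZero p q : term p q
| tAdd p q of term p q & term p q : term p q
| tScale p q of k & term p q : term p q
| tInd p q of (p <= q)%VS : term p q
| tRes p q of (p <= q)%VS : term q p
| tInv p q of (exists r, opposite_across hR r p q) : term q p.

Definition tTau p q : term p q :=
  tComp (tRes (parab_sub_full q)) (tInd (parab_sub_full p)).

Inductive teq : forall p q, term p q -> term p q -> Prop :=
| teq_refl p q (a : term p q) : teq a a
| teq_sym p q (a b : term p q) : teq a b -> teq b a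
| teq_trans p q (a b c : term p q) : teq a b -> teq b c -> teq a c
| teq_comp p q r (b b' : term q r) (a a' : term p q) :
    teq b b' -> teq a a' -> teq (tComp b a) (tComp b' a')
| teq_add p q (a a' b b' : term p q) :
    teq a a' -> teq b b' -> teq (tAdd a b) (tAdd a' b')
| teq_scale p q c (a a' : term p q) : teq a a' -> teq (tScale c a) (tScale c a')
| teq_addA p q (a b c : term p q) :
    teq (tAdd a (tAdd b c)) (tAdd (tAdd a b) c)
| teq_addC p q (a b : term p q) : teq (tAdd a b) (tAdd b a)
| teq_add0 p q (a : term p q) : teq (tAdd (tZero p q) a) a
| teq_addN p q (a : term p q) : teq (tAdd (tScale (-1) a) a) (tZero p q)
| teq_scaleA p q c d (a : term p q) :
    teq (tScale c (tScale d a)) (tScale (c * d) a)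
| teq_scale1 p q (a : term p q) : teq (tScale 1 a) a
| teq_scaleDr p q c (a b : term p q) :
    teq (tScale c (tAdd a b)) (tAdd (tScale c a) (tScale c b))
| teq_scaleDl p q c d (a : term p q) :
    teq (tScale (c + d) a) (tAdd (tScale c a) (tScale d a))
| teq_compA p q r s (c : term r s) (b : term q r) (a : term p q) :
    teq (tComp c (tComp b a)) (tComp (tComp c b) a)
| teq_compm1 p q (a : term p q) : teq (tComp a (tId p)) a
| teq_comp1m p q (a : term p q) : teq (tComp (tId q) a) a
| teq_compPl p q r c (b b' : term q r) (a : term p q) :
    teq (tComp (tAdd (tScale c b) b') a)
        (tAdd (tScale c (tComp b a)) (tComp b' a))
| teq_compPr p q r c (b : term q r) (a a' : term p q) :
    teq (tComp b (tAdd (tScale c a) a'))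
        (tAdd (tScale c (tComp b a)) (tComp b a'))
| teq_Ind1 p (pp : (p <= p)%VS) : teq (tInd pp) (tId p)
| teq_Res1 p (pp : (p <= p)%VS) : teq (tRes pp) (tId p)
| teq_IndInd p q r (pq : (p <= q)%VS) (qr : (q <= r)%VS) (pr : (p <= r)%VS) :
    teq (tComp (tInd qr) (tInd pq)) (tInd pr)
| teq_ResRes p q r (pq : (p <= q)%VS) (qr : (q <= r)%VS) (pr : (p <= r)%VS) :
    teq (tComp (tRes pq) (tRes qr)) (tRes pr)
| teq_ResInd p q (pq : (p <= q)%VS) : teq (tComp (tRes pq) (tInd pq)) (tId p)
| teq_collinear p q r of collinear hR p q r :
    teq (tTau p r) (tComp (tTau q r) (tTau p q))
| teq_invl p q (e : exists r, opposite_across hR r p q) :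
    teq (tComp (tInv e) (tTau p q)) (tId p)
| teq_invr p q (e : exists r, opposite_across hR r p q) :
    teq (tComp (tTau p q) (tInv e)) (tId q).

HB.instance Definition _ p q := gen_eqMixin (term p q).
HB.instance Definition _ p q := gen_choiceMixin (term p q).

Definition teqb p q : rel (term p q) := fun a b => `[< teq a b >].

Lemma teqb_refl p q : reflexive (@teqb p q).
Proof. by move=> a; apply/asboolP/teq_refl. Qed.

Lemma teqb_sym p q : symmetric (@teqb p q).
Proof. by move=> a b; apply/asboolP/asboolP => /teq_sym. Qed.

Lemma teqb_trans p q : transitive (@teqb p q).
Proof.
by move=> b a c /asboolP ab /asboolP bc; apply/asboolP; apply: teq_trans bc.
Qed.

Canonical teq_equiv p q :=
  EquivRel (@teqb p q) (@teqb_refl p q) (@teqb_sym p q) (@teqb_trans p q).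

Definition qhom p q := {eq_quot (teq_equiv p q)}%qT.
HB.instance Definition _ p q := Choice.on (qhom p q).

Definition qcls p q (a : term p q) : qhom p q := \pi_(qhom p q)%qT a.

Lemma qclsP p q (a b : term p q) : qcls a = qcls b <-> teq a b.
Proof.
split; first by move=> /eqquotP/asboolP.
by move=> ab; apply/eqquotP/asboolP.
Qed.

Lemma qrepr p q (x : qhom p q) : qcls (repr x) = x.
Proof. exact: reprK. Qed.

Lemma qcls_repr p q (a : term p q) : teq (repr (qcls a)) a.
Proof. by apply/qclsP; rewrite qrepr. Qed.

Definition qadd p q (x y : qhom p q) := qcls (tAdd (repr x) (repr y)).
Definition qscale p q (c : k) (x : qhom p q) := qcls (tScale c (repr x)).
Definition qcomp p q r (y : qhom q r) (x : qhom p q) :=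
  qcls (tComp (repr y) (repr x)).

Lemma qaddE p q (a b : term p q) : qadd (qcls a) (qcls b) = qcls (tAdd a b).
Proof. by apply/qclsP; apply: teq_add; apply: qcls_repr. Qed.

Lemma qscaleE p q c (a : term p q) : qscale c (qcls a) = qcls (tScale c a).
Proof. by apply/qclsP; apply: teq_scale; apply: qcls_repr. Qed.

Lemma qcompE p q r (b : term q r) (a : term p q) :
  qcomp (qcls b) (qcls a) = qcls (tComp b a).
Proof. by apply/qclsP; apply: teq_comp; apply: qcls_repr. Qed.

Lemma qaddA p q : associative (@qadd p q).
Proof.
move=> x y z; rewrite -(qrepr x) -(qrepr y) -(qrepr z) !qaddE.
exact/qclsP/teq_addA.
Qed.

Lemma qaddC p q : commutative (@qadd p q).
Proof. by move=> x y; apply/qclsP/teq_addC. Qed.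

Lemma qadd0 p q : left_id (qcls (tZero p q)) (@qadd p q).
Proof. by move=> x; rewrite -(qrepr x) qaddE; apply/qclsP/teq_add0. Qed.

Lemma qaddN p q :
  left_inverse (qcls (tZero p q)) (@qscale p q (-1)) (@qadd p q).
Proof. by move=> x; rewrite -(qrepr x) qscaleE qaddE; apply/qclsP/teq_addN. Qed.

HB.instance Definition _ p q := GRing.isZmodule.Build (qhom p q)
  (@qaddA p q) (@qaddC p q) (@qadd0 p q) (@qaddN p q).

Lemma qscaleA p q c d (x : qhom p q) :
  qscale c (qscale d x) = qscale (c * d) x.
Proof. by rewrite -(qrepr x) !qscaleE; apply/qclsP/teq_scaleA. Qed.

Lemma qscale1 p q : left_id 1 (@qscale p q).
Proof. by move=> x; rewrite -(qrepr x) qscaleE; apply/qclsP/teq_scale1. Qed.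

Lemma qscaleDr p q : right_distributive (@qscale p q) +%R.
Proof.
move=> c x y; rewrite /GRing.add /= -(qrepr x) -(qrepr y).
by rewrite qaddE !qscaleE qaddE; apply/qclsP/teq_scaleDr.
Qed.

Lemma qscaleDl p q (x : qhom p q) : {morph (@qscale p q)^~ x : c d / c + d}.
Proof.
move=> c d; rewrite [RHS]/GRing.add /= -(qrepr x) !qscaleE qaddE.
exact/qclsP/teq_scaleDl.
Qed.

HB.instance Definition _ p q := GRing.Zmodule_isLmodule.Build k (qhom p q)
  (@qscaleA p q) (@qscale1 p q) (@qscaleDr p q) (@qscaleDl p q).

Lemma qcompA p q r s (c : qhom r s) (b : qhom q r) (a : qhom p q) :
  qcomp c (qcomp b a) = qcomp (qcomp c b) a.
Proof.
by rewrite -(qrepr a) -(qrepr b) -(qrepr c) !qcompE; apply/qclsP/teq_compA.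
Qed.

Lemma qcompm1 p q (a : qhom p q) : qcomp a (qcls (tId p)) = a.
Proof. by rewrite -(qrepr a) qcompE; apply/qclsP/teq_compm1. Qed.

Lemma qcomp1m p q (a : qhom p q) : qcomp (qcls (tId q)) a = a.
Proof. by rewrite -(qrepr a) qcompE; apply/qclsP/teq_comp1m. Qed.

Lemma qlinE p q c (a b : term p q) :
  c *: qcls a + qcls b = qcls (tAdd (tScale c a) b).
Proof. by rewrite -qaddE -qscaleE. Qed.

Lemma qcompPl p q r c (b b' : qhom q r) (a : qhom p q) :
  qcomp (c *: b + b') a = c *: qcomp b a + qcomp b' a.
Proof.
rewrite -(qrepr a) -(qrepr b) -(qrepr b') qlinE !qcompE qlinE.
exact/qclsP/teq_compPl.
Qed.

Lemma qcompPr p q r c (b : qhom q r) (a a' : qhom p q) :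
  qcomp b (c *: a + a') = c *: qcomp b a + qcomp b a'.
Proof.
rewrite -(qrepr a) -(qrepr b) -(qrepr a') qlinE !qcompE qlinE.
exact/qclsP/teq_compPr.
Qed.

Definition doubleIncidence : linCat k :=
  @LinCat k parab (fun p q => qhom p q) (fun p => qcls (tId p))
    qcomp qcompA qcompm1 qcomp1m qcompPl qcompPr.

Local Notation Q := doubleIncidence.

Definition Ind p q (pq : (p <= q)%VS) : hom (l := Q) p q := qcls (tInd pq).
Definition Res p q (pq : (p <= q)%VS) : hom (l := Q) q p := qcls (tRes pq).

(* The transition morphism is taken through g itself; by tauE any other
   parabolic subalgebra containing p and q gives the same morphism. *)
Definition tau p q : hom (l := Q) p q :=
  Res (parab_sub_full q) \oQ Ind (parab_sub_full p).

Lemma tau_cls p q : tau p q = qcls (tTau p q).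
Proof. exact: qcompE. Qed.

Lemma IndInd p q r (pq : (p <= q)%VS) (qr : (q <= r)%VS) (pr : (p <= r)%VS) :
  Ind qr \oQ Ind pq = Ind pr.
Proof. by rewrite /comp /= qcompE; apply/qclsP/teq_IndInd. Qed.

Lemma ResRes p q r (pq : (p <= q)%VS) (qr : (q <= r)%VS) (pr : (p <= r)%VS) :
  Res pq \oQ Res qr = Res pr.
Proof. by rewrite /comp /= qcompE; apply/qclsP/teq_ResRes. Qed.

Lemma ResInd p q (pq : (p <= q)%VS) : Res pq \oQ Ind pq = idm (l := Q) p.
Proof. by rewrite /comp /= qcompE; apply/qclsP/teq_ResInd. Qed.

Lemma tauE p q r (pr : (p <= r)%VS) (qr : (q <= r)%VS) :
  Res qr \oQ Ind pr = tau p q.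
Proof.
rewrite /tau -(ResRes qr (parab_sub_full r)) -(IndInd pr (parab_sub_full r)).
by rewrite -compA [X in _ = _ \oQ X]compA ResInd comp1m.
Qed.

Lemma tau_collinear p q r : collinear hR p q r -> tau p r = tau q r \oQ tau p q.
Proof.
move=> pqr; rewrite !tau_cls /comp /= qcompE.
exact/qclsP/teq_collinear.
Qed.

Lemma opposite_acrossC r p q :
  opposite_across hR r p q -> opposite_across hR r q p.
Proof.
move=> [[pr qr] cp cq LL [v [Mv Sp Sq]]]; split=> //; exists (- v); split.
- move=> [n [c [t [ct vE]]]]; apply: Mv; exists n, c, (fun i => - t i).
  split=> //; rewrite -[LHS]opprK vE -sumrN; apply: eq_bigr => i _.
  by rewrite rmorphN scaleNr.
- by move=> x /Sq[w Mw [s s0 ->]]; exists w => //; exists s; rewrite ?scalerN.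
- move=> x /Sp[w Mw [s s0 ->]]; exists w => //; exists s => //.
  by rewrite scalerN opprK.
Qed.

Lemma tau_invertible r p q : opposite_across hR r p q ->
  exists2 u : hom (l := Q) q p, u \oQ tau p q = idm (l := Q) p
                              & tau p q \oQ u = idm (l := Q) q.
Proof.
move=> e; have e' : exists r, opposite_across hR r p q by exists r.
exists (qcls (tInv e')); rewrite tau_cls /comp /= qcompE; apply/qclsP.
- exact: teq_invl.
- exact: teq_invr.
Qed.

End DoubleIncidence.

(* Main.v *)
From HB Require Import structures.
Require Import Defs.
From mathcomp Require Import all_boot all_order all_algebra.
From mathcomp Require Import boolp classical_sets reals complex.
From mathcomp Require Import ring lra zify.

Set Implicit Arguments.
Unset Strict Implicit.
Unset Printing Implicit Defensive.

Import Order.TTheory GRing.Theory Num.Theory.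
Import passmx.
Local Open Scope ring_scope.

(** Write [p1 o p2] for the Tits product.  In the double incidence category
[Ind] and [Res] are themselves transition morphisms ([Ind_tau], [Res_tau]), so
the formula says that [tau p1 p2] is the composite of the transition morphisms
along p1, p1 o p2, p2 o p1, p2.  Take points x and y in the cells of p1 and p2.
The segment from x to y enters the cell of p1 o p2 right after x and leaves
through the cell of p2 o p1 right before y; hence (p1, p1 o p2, p2) and
(p1 o p2, p2 o p1, p2) are collinear triples ([tits_collinear]), and the
formula is the relation for collinear triples used twice.

All the work is in this geometric claim ([tits_cell]), which needs, for a
subalgebra U containing h, a point of the real form at which each root a of U
is nonnegative, and positive as soon as -a is not a root of U
([root_dominant_sign]).  Such a point, [dominant U], is an element dual to the
sum of the roots of U for the form (s, t) |-> sum_b b(s) b(t) on h, where b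
ranges over the roots of g.  The root a takes there a positive multiple of the
value of the sum of the roots of U at the coroot of a.  In that sum the roots b
for which the reflection s_a(b) is again a root of U cancel out, and for every
other root b of U the value at the coroot is positive: [ad e], with e of weight
a, moves a root of U with value -n up to its reflection, because e^n is
injective on the eigenspace of eigenvalue -n of an sl2-triple ([sl2_inj]).

A root of [(p :&: q) + n_p] is a root of [p :&: q] or of n_p.  A root a of n_p is
positive at [dominant p], since an sl2-triple with e in the radical of p and f
in p would lie in a solvable ideal ([solvable_no_sl2]).  A root of [p :&: q] is
nonnegative on the whole segment, and if it vanishes at an interior point its
opposite is a root of p and of q, hence of [p :&: q] because root spaces are lines
([root_line]); so it vanishes on the whole cone.  Since the roots are finite
in number, all points of the segment other than [dominant p] and close enough
to it lie in the cell of p o q.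

The existence of sl2-triples rests on the nondegeneracy of the Killing form
modulo the centre.  Cartan's criterion is replaced by a version of Engel's
theorem for subalgebras stable under h: the elements of the Killing radical
whose component of weight 0 is central form an ideal, whose weight vectors are
ad-nilpotent, and which is therefore solvable, hence central by reductivity
([killing_nondegenerate]). *)

(** * Brackets as linear maps *)

Section Bracket.
Variables (F : fieldType) (g : lieAlgebra F).
Implicit Types (x y z : g) (U V : {vspace g}).

Lemma bracket_is_linear x : linear (bracket x).
Proof. by move=> c y z; rewrite bracketDr. Qed.
HB.instance Definition _ x :=
  GRing.isLinear.Build F g g _ (bracket x) (bracket_is_linear x).

Lemma bracketNl x y : bracket (- x) y = - bracket x y.
Proof. by rewrite bracketC linearN opprK; apply: bracketC. Qed.

Lemma bracketZl c x y : bracket (c *: x) y = c *: bracket x y.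
Proof. by rewrite bracketC linearZ -scalerN -(bracketC x y). Qed.

Lemma bracketDl1 x y z : bracket (x + y) z = bracket x z + bracket y z.
Proof. by rewrite bracketC linearD opprD -(bracketC x z) -(bracketC y z). Qed.

Lemma bracketBl x y z : bracket (x - y) z = bracket x z - bracket y z.
Proof. by rewrite bracketDl1 bracketNl. Qed.

Lemma bracket0l x : bracket 0 x = 0.
Proof. by rewrite bracketC bracket0 oppr0. Qed.

Lemma bracket_suml I (r : seq I) (P : pred I) (E : I -> g) y :
  bracket (\sum_(i <- r | P i) E i) y = \sum_(i <- r | P i) bracket (E i) y.
Proof.
by rewrite bracketC linear_sum -sumrN; apply: eq_bigr => i _; rewrite (bracketC (E i)).
Qed.

Lemma bracketA x y z :
  bracket (bracket x y) z = bracket x (bracket y z) - bracket y (bracket x z).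
Proof.
have := jacobi x y z; rewrite (bracketC z (bracket x y)) (bracketC z x).
rewrite linearN => /eqP; rewrite subr_eq0 => /eqP <- //.
Qed.

Lemma bracket_leibniz x y z :
  bracket x (bracket y z) = bracket (bracket x y) z + bracket y (bracket x z).
Proof. by rewrite bracketA subrK. Qed.

(** A subspace of largest dimension among those on which [P] holds contains
every vector satisfying [P]: this turns a linear condition into a subspace. *)
Lemma vspace_of_predicate (V : vectType F) (P : V -> Prop) : P 0 ->
  (forall c (x y : V), P x -> P y -> P (c *: x + y)) ->
  exists U : {vspace V}, forall x : V, x \in U <-> P x.
Proof.
move=> P0 Plin.
pose Q n :=
  `[< exists U : {vspace V}, (forall x : V, x \in U -> P x) /\ \dim U = n >].
have Q0 : exists n, Q n.
  exists 0%N; apply/asboolP; exists 0%VS; split; last exact: dimv0.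
  by move=> x; rewrite memv0 => /eqP->.
have Qb n : Q n -> (n <= \dim {:V})%N.
  by move=> /asboolP[U [_ <-]]; rewrite dimvS ?subvf.
case: (ex_maxnP Q0 Qb) => n /asboolP[U [UP dU]] nmax; exists U => x.
split=> [|Px]; first exact: UP.
have dUx : (\dim (U + <[x]>)%VS <= \dim U)%N.
  rewrite dU; apply: nmax; apply/asboolP; exists (U + <[x]>)%VS; split=> // y.
  move=> /memv_addP[u uU [_ /vlineP[c ->] ->]]; rewrite addrC.
  by apply: Plin => //; apply: UP.
move: dUx; rewrite (geq_leqif (dimv_leqif_sup (addvSl U <[x]>))) => /subvP; apply.
by rewrite memvE addvSr.
Qed.

End Bracket.

(** * Strings for sl2-triples *)

Section SL2.
Variables (F : numFieldType) (g : lieAlgebra F).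
Implicit Types (x y z v : g).

Definition ad_nilpotent x := exists N, forall v, iter N (bracket x) v = 0.

Lemma iter_bracket0 x m : iter m (bracket x) 0 = 0.
Proof. by elim: m => //= m ->; rewrite linear0. Qed.

Lemma iter_bracketB x m (c : F) y z :
  iter m (bracket x) (y - c *: z) = iter m (bracket x) y - c *: iter m (bracket x) z.
Proof. by elim: m => //= m ->; rewrite linearB linearZ. Qed.

Lemma nilp_last x v : ad_nilpotent x -> v != 0 ->
  exists k, iter k (bracket x) v != 0 /\ iter k.+1 (bracket x) v = 0.
Proof.
move=> [N xN] v0.
have ex : exists k, iter k (bracket x) v == 0 by exists N; rewrite xN.
case: (ex_minnP ex) => -[|k] /eqP kv kmin; first by case/eqP: v0.
exists k; split=> //; apply/negP => /kmin; by rewrite ltnn.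
Qed.

Lemma iter_weight e t v (al mu : F) m : bracket t e = al *: e ->
  bracket t v = mu *: v ->
  bracket t (iter m (bracket e) v) = (mu + m%:R * al) *: iter m (bracket e) v.
Proof.
move=> te tv; elim: m => [|m IH] /=; first by rewrite mul0r addr0.
rewrite bracket_leibniz te IH bracketZl linearZ -scalerDl /=; congr (_ *: _).
by rewrite -(natr1 m); ring.
Qed.

(** One has e f^(k+1) v = d_k f^k v with d_0 = d, and moving e across one more f
gives d_k = d + k mu - al k(k+1)/2.  If f^k v is the last nonzero vector of the
string, then d_k = 0.  The value al = 2 is that of an sl2-triple; for al = 0 the
elements e, f, t span a Heisenberg algebra. *)
Lemma sl2_string e f t v (al mu d : F) :
  bracket e f = t -> bracket t f = - al *: f -> ad_nilpotent f ->
  v != 0 -> bracket t v = mu *: v -> bracket e (bracket f v) = d *: v ->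
  exists k : nat, d = al * (k * k.+1)%:R / 2 - k%:R * mu.
Proof.
move=> eft tf fN v0 tv efv.
have step k : bracket e (iter k.+1 (bracket f) v) =
    (d + k%:R * mu - al * (k * k.+1)%:R / 2) *: iter k (bracket f) v.
  elim: k => [|k IH] /=; first by rewrite efv !mul0n mulr0 !mul0r subr0 addr0.
  rewrite bracket_leibniz eft IH linearZ /=.
  have := iter_weight k.+1 tf tv => /= ->.
  rewrite -scalerDl; congr (_ *: _).
  by rewrite !natrM -!(natr1 k.+1) -!(natr1 k); field.
have [m [fm fm1]] := nilp_last fN v0; exists m.
have := step m; rewrite fm1 linear0 => /esym/eqP.
rewrite scaler_eq0 (negPf fm) orbF => /eqP H.
by rewrite -[LHS]addr0 -[0]oppr0 -H; ring.
Qed.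

Variables (e f t : g).
Hypotheses (eft : bracket e f = t) (te : bracket t e = 2 *: e)
  (tf : bracket t f = - 2 *: f) (eN : ad_nilpotent e) (fN : ad_nilpotent f).

(** The string upwards is the string downwards of the triple (f, e, -t). *)
Lemma sl2_string_up v (mu d : F) :
  v != 0 -> bracket t v = mu *: v -> bracket f (bracket e v) = d *: v ->
  exists k : nat, d = (k * k.+1)%:R + k%:R * mu.
Proof.
move=> v0 tv fev.
have [||||//||k ->] := @sl2_string f e (- t) v 2 (- mu) d.
- by rewrite bracketC eft.
- by rewrite bracketNl te scaleNr.
- exact: eN.
- exact: v0.
- by rewrite bracketNl tv scaleNr.
- by rewrite fev.
by exists k; field.
Qed.

(** The last nonzero vector e^s v is killed by e, so the string below it forces
its eigenvalue mu + 2s to be a natural number. *)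
Lemma sl2_integral v (mu : F) : v != 0 -> bracket t v = mu *: v ->
  exists m : int, mu = m%:~R.
Proof.
move=> v0 tv; have [s [es es1]] := nilp_last eN v0.
have tu := iter_weight s te tv; set u := iter s _ v in es tu.
have efu : bracket e (bracket f u) = (mu + s%:R * 2) *: u.
  by rewrite bracket_leibniz eft tu -[bracket e u]/(iter s.+1 (bracket e) v) es1 linear0 addr0.
have [k E] := sl2_string eft tf fN es tu efu.
exists (k%:Z - s%:Z * 2); rewrite rmorphB rmorphM /= -!pmulrn.
have k1 : k.+1%:R != 0 :> F by rewrite pnatr_eq0.
apply: (mulfI k1); move: E; rewrite natrM -(natr1 k) => E.
have -> : (k%:R + 1) * mu = (mu + s%:R * 2) +
    (k%:R * (mu + s%:R * 2)) - (k%:R + 1) * (s%:R * 2) by ring.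
by rewrite {1}E; field.
Qed.

(** If e^(j+1) v = 0, applying f and moving fe across e^j gives
e^j (fe v - c_j v) = 0 with c_j = j(j+1-n); by induction on j, fe v = c_j v, and
c_j <= 0 for j < n.  But the eigenvalue of fe = ef + n is at least n by
[sl2_string]. *)
Lemma sl2_inj v n m : (m <= n)%N -> bracket t v = - n%:R *: v ->
  iter m (bracket e) v = 0 -> v = 0.
Proof.
move=> mn.
(* fe e^j = e^j (fe - c j) on the eigenspace of eigenvalue -n. *)
pose c j : F := j%:R * (- n%:R + j%:R + 1).
have comm j u : bracket t u = - n%:R *: u ->
    bracket f (bracket e (iter j (bracket e) u)) =
    iter j (bracket e) (bracket f (bracket e u) - c j *: u).
  move=> tu; elim: j => [|j IH]; first by rewrite /c mul0r scale0r subr0.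
  rewrite /= -[bracket e (iter j _ u)]/(iter j.+1 (bracket e) u).
  have -> w : bracket f (bracket e w) = bracket e (bracket f w) - bracket t w.
    by rewrite -eft bracketA opprB addrC subrK.
  rewrite (iter_weight j.+1 te tu) /= IH !iter_bracketB !linearB -!addrA; congr (_ + _).
  rewrite !linearZ /= -scalerDl; congr (_ *: _).
  by rewrite /c -!(natr1 j); ring.
elim: m mn v => [//|j IH] jn v tv ev.
have /IH : bracket t (bracket f (bracket e v) - c j *: v) =
           - n%:R *: (bracket f (bracket e v) - c j *: v).
  rewrite linearB linearZ /= !(bracket_leibniz t) te tf tv !bracketZl !linearD !linearZ /=.
  by rewrite addrA -scalerDl addNr scale0r add0r.
have /= -> := esym (comm j v tv).
rewrite -[bracket e (iter j _ v)]/(iter j.+1 (bracket e) v) ev linear0 (ltnW jn).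
move=> /(_ isT erefl) /eqP; rewrite subr_eq0 => /eqP fev.
apply: contrapT => /eqP v0.
have efv : bracket e (bracket f v) = (c j - n%:R) *: v.
  by rewrite bracket_leibniz eft fev tv -scalerDl addrC.
have [k E] := sl2_string eft tf fN v0 tv efv.
have : c j = n%:R + (k * k.+1)%:R + k%:R * n%:R :> F.
  by rewrite -[LHS](subrK n%:R) E; field.
(* c j <= 0 is incompatible with its expression as n plus natural numbers. *)
have jn1 : (j + (n - j - 1) + 1 = n)%N by lia.
rewrite /c -jn1; set i := (n - j - 1)%N => /eqP.
rewrite -subr_eq0 -oppr_eq0 => /eqP H.
have : ((j + i + 1) + k * k.+1 + k * (j + i + 1) + j * i)%:R = 0 :> F.
  by rewrite -H !natrD !natrM !natrD -(natr1 k) mulr1n; ring.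
by move/eqP; rewrite pnatr_eq0; lia.
Qed.

End SL2.

(** * Weight decomposition under a Cartan subalgebra *)

Section Weights.
Variables (R : realType) (g : lieAlgebra R[i]) (h : {vspace g}).
Hypothesis h_cartan : cartan h.
Implicit Types (U V : {vspace g}) (a b : weight h) (x y z : g).

Definition hstable U := forall (t : subvs_of h) x, x \in U -> bracket (vsval t) x \in U.

Lemma cartan_comm x y : x \in h -> y \in h -> bracket x y = 0.
Proof.
move=> xh yh; apply/eqP; rewrite -memv0.
by have [<- _ _] := h_cartan; apply: bracketv_sub.
Qed.

Lemma cartan_self x : (forall t : subvs_of h, bracket (vsval t) x = 0) -> x \in h.
Proof.
move=> hx; have [_ hmax _] := h_cartan.
have hx' y : y \in h -> bracket y x = 0.
  by move=> yh; have := hx (vsproj h y); rewrite vsprojK.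
rewrite -(hmax (h + <[x]>)%VS) ?addvSl //; first by rewrite memvE addvSr.
apply/eqP; rewrite -subv0; apply: bracketv_min => u v.
move=> /memv_addP[u1 uh [_ /vlineP[c ->] ->]] /memv_addP[v1 vh [_ /vlineP[d ->] ->]].
rewrite bracketDlr !bracketZl !linearZ /= bracketxx hx' // (bracketC x) hx' //.
by rewrite cartan_comm // !(scaler0, oppr0, addr0) mem0v.
Qed.

(** The operators [ad t], for t in h, are diagonalizable and commute, so they
are diagonal in a common basis. *)
Lemma weight_basis : exists (a : 'I_(\dim {:g}) -> weight h) (v : 'I_(\dim {:g}) -> g),
  (forall i, weight_vector (a i) (v i)) /\
  (forall x, exists c : 'I_(\dim {:g}) -> R[i], x = \sum_i c i *: v i).
Proof.
pose e := vbasis {:g}; have eb : basis_of {:g} e := vbasisP _.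
pose M (t : g) := mxof e e (linfun (bracket t)).
have Mv t x : rVof e (bracket t x) = rVof e x *m M t.
  by rewrite -(rVof_app _ eb) lfunE.
have Mlin c t t' : M (c *: t + t') = c *: M t + M t'.
  rewrite /M; have -> : linfun (bracket (c *: t + t')) =
      c *: linfun (bracket t) + linfun (bracket t').
    by apply/lfunP => x; rewrite add_lfunE scale_lfunE !lfunE /= bracketDl.
  by rewrite linearP.
have /codiagonalizableP : {in map M (vbasis h) &, forall A B, comm_mx A B} /\
    {in map M (vbasis h), forall A, diagonalizable A}.
  split.
    move=> _ _ /mapP[t /vbasis_mem th ->] /mapP[t' /vbasis_mem th' ->].
    rewrite /comm_mx -!mxof_comp //; congr mxof; apply/lfunP => x.
    rewrite !comp_lfunE !lfunE /=.
    have := bracketA t t' x; rewrite (cartan_comm th th') bracket0l => /esym/eqP.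
    by rewrite subr_eq0 => /eqP.
  move=> _ /mapP[t /vbasis_mem th ->].
  have [_ _ /(_ t th) [b bb bt]] := h_cartan.
  have sb : size b == \dim {:g} by have /andP[/eqP <- /eqP <-] := bb.
  pose bT := Tuple sb; have bTb : basis_of {:g} bT by [].
  pose P := mxof bT e \1%VF.
  exists P; first rewrite -row_free_unit.
    apply/row_freeP; exists (mxof e bT \1%VF).
    by rewrite -mxof_comp // comp_lfun1l mxof1 ?(basis_free bTb).
  have dia (i : 'I_(\dim {:g})) : exists c, bracket t bT`_i = c *: bT`_i.
    by apply: bt; apply: mem_nth; rewrite (eqP sb).
  have [d bd] := choice dia.
  apply/diagonalizable_forPex; exists (\row_i d i).
  apply: simmxW.
    apply/row_freeP; exists (mxof e bT \1%VF).
    by rewrite -mxof_comp // comp_lfun1l mxof1 ?(basis_free bTb).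
  rewrite /M -mxof_comp // comp_lfun1r.
  have -> : diag_mx (\row_i d i) = mxof bT bT (linfun (bracket t)).
    apply/row_matrixP => i; rewrite [RHS]rowE mul_mxof vecof_delta lfunE /=.
    by rewrite bd linearZ /= rVofE // row_diag_mx mxE.
  by rewrite -mxof_comp // comp_lfun1l.
case=> P Pu /allP PA.
pose v i := vecof e (row i P).
have ev i (j : 'I_(\dim h)) : exists d, bracket (vbasis h)`_j (v i) = d *: v i.
  have /PA /diagonalizable_forPex[D /(simmxP Pu) PD] : M (vbasis h)`_j \in map M (vbasis h).
    by apply: map_f; apply: mem_nth; rewrite size_tuple.
  exists (D 0 i); apply: (can_inj (rVofK eb)).
  by rewrite Mv linearZ /= vecofK // -row_mul PD row_mul row_diag_mx -scalemxAl -rowE.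
have hv i : exists a : weight h, weight_vector a (v i).
  have [d vd] := choice (ev i).
  pose a (t : subvs_of h) : R[i]^o := \sum_j coord (vbasis h) j (vsval t) * d j.
  have al : linear a.
    move=> c t t'; rewrite /a scaler_sumr -big_split /=; apply: eq_bigr => j _.
    by rewrite !linearP /= mulrDl -mulrA.
  pose aL : {linear subvs_of h -> R[i]^o} :=
    HB.pack a (GRing.isLinear.Build _ _ _ _ a al).
  exists (linfun aL) => t; rewrite lfunE /=.
  rewrite [vsval t in LHS](coord_vbasis (subvsP t)) bracket_suml.
  by rewrite /a scaler_suml; apply: eq_bigr => j _; rewrite bracketZl vd scalerA.
have [a va] := choice hv.
exists a, v; split=> // x; exists (fun i => (rVof e x *m invmx P) 0 i).
apply: (can_inj (rVofK eb)); rewrite -[LHS](mulmxKV Pu) mulmx_sum_row linear_sum.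
by apply: eq_bigr => i _; rewrite linearZ /= vecofK.
Qed.

Lemma hstable_line a x : weight_vector a x -> hstable <[x]>.
Proof. by move=> ax t _ /vlineP[c ->]; rewrite linearZ /= ax !rpredZ ?memv_line. Qed.

Lemma weight_line a x y : weight_vector a x -> y \in <[x]>%VS -> weight_vector a y.
Proof.
by move=> ax /vlineP[c ->] t; rewrite linearZ /= ax !scalerA [c * _]mulrC.
Qed.

Lemma weight_uniq a b x : weight_vector a x -> weight_vector b x -> a != b -> x = 0.
Proof.
move=> ax bx /eqP ab; apply: contrapT => /eqP x0; apply: ab; apply/lfunP => t.
have /eqP := ax t; rewrite bx -subr_eq0 -scalerBl scaler_eq0 (negPf x0) orbF.
by rewrite subr_eq0 => /eqP.
Qed.

(** The operator is the product of (ad t_b - b(t_b)) / (a(t_b) - b(t_b)) over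
the weights b <> a in [s], where t_b separates a from b.  As a polynomial in
elements of ad h it preserves every h-stable subspace. *)
Lemma weight_separation a (s : seq (weight h)) : exists phi : 'End(g),
  [/\ forall U x, hstable U -> x \in U -> phi x \in U,
      forall x, weight_vector a x -> phi x = x &
      forall b x, b \in s -> b != a -> weight_vector b x -> phi x = 0].
Proof.
elim: s => [|b s [phi [phiU phia phib]]].
  by exists \1%VF; split=> [U x _|x _|]; rewrite ?id_lfunE.
have [->|/eqP ba] := eqVneq b a.
  exists phi; split=> // c x; rewrite inE => /orP[/eqP->|]; first by rewrite eqxx.
  exact: phib.
have [t abt] : exists t, a t - b t != 0.
  apply: contrapT => H; apply: ba; apply/lfunP => t; apply: contrapT => /eqP abt.
  by apply: H; exists t; rewrite subr_eq0 eq_sym.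
pose psi := ((a t - b t)^-1 *: (linfun (bracket (vsval t)) - b t *: \1))%VF.
have psiE x : psi x = (a t - b t)^-1 *: (bracket (vsval t) x - b t *: x).
  by rewrite scale_lfunE add_lfunE opp_lfunE scale_lfunE lfunE id_lfunE.
exists (psi \o phi)%VF; split=> [U x hU xU|x ax|c x].
- by rewrite comp_lfunE psiE rpredZ // rpredB ?rpredZ ?phiU // hU ?phiU.
- by rewrite comp_lfunE phia // psiE ax -scalerBl scalerA mulVf ?scale1r.
- rewrite comp_lfunE psiE inE => /orP[/eqP-> _ bx|cs ca cx].
    have -> : bracket (vsval t) (phi x) = b t *: phi x.
      apply: (weight_line bx); apply: phiU (memv_line x).
      exact: hstable_line bx.
    by rewrite subrr scaler0.
  by rewrite (phib c) // linear0 scaler0 subrr scaler0.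
Qed.

Lemma weight_projections : exists (wts : seq (weight h)) (pr : weight h -> 'End(g)),
  [/\ uniq wts,
      forall U a x, hstable U -> x \in U -> pr a x \in U,
      forall a x, weight_vector a (pr a x),
      forall a x, weight_vector a x -> pr a x = x
    & forall x, x = \sum_(a <- wts) pr a x].
Proof.
have [w [v [wv vx]]] := weight_basis.
pose wts := undup (codom w).
have [pr prP] := choice (fun a => weight_separation a wts).
have prv a i : pr a (v i) = if a == w i then v i else 0.
  have [_ pra prb] := prP a.
  have [E|ne] := eqVneq a (w i); first by rewrite pra // E.
  by rewrite (prb (w i)) // ?mem_undup ?codom_f // eq_sym.
exists wts, pr; split.
- exact: undup_uniq.
- by move=> U a x; have [/(_ U x)] := prP a.
- move=> a x t; have [c ->] := vx x.
  rewrite !linear_sum; apply: eq_bigr => i _.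
  rewrite !linearZ /= prv; case: eqP => [->|_]; last by rewrite !(linear0, scaler0).
  by rewrite wv !scalerA mulrC.
- by move=> a x; have [_ /(_ x)] := prP a.
- move=> x; have [c ->] := vx x.
  transitivity (\sum_i \sum_(a <- wts) pr a (c i *: v i)); last first.
    by rewrite exchange_big; apply: eq_bigr => a _; rewrite linear_sum.
  apply: eq_bigr => i _.
  rewrite (bigD1_seq (w i)) ?mem_undup ?codom_f ?undup_uniq //= big1 => [|a ne].
    by rewrite linearZ /= prv eqxx addr0.
  by rewrite linearZ /= prv (negPf ne) scaler0.
Qed.

(** A finite list containing all the weights of h in g. *)
Definition wts : seq (weight h) := sval (cid weight_projections).
(** The projection onto the weight space of a along the other weight spaces. *)
Definition wproj : weight h -> 'End(g) := sval (cid (svalP (cid weight_projections))).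

Lemma wprojP : [/\ uniq wts,
      forall U a x, hstable U -> x \in U -> wproj a x \in U,
      forall a x, weight_vector a (wproj a x),
      forall a x, weight_vector a x -> wproj a x = x
    & forall x, x = \sum_(a <- wts) wproj a x].
Proof. exact: svalP (cid (svalP (cid weight_projections))). Qed.

Lemma wproj_in U a x : hstable U -> x \in U -> wproj a x \in U.
Proof. by have [_ H _ _ _] := wprojP; apply: H. Qed.
Lemma wprojV a x : weight_vector a (wproj a x).
Proof. by have [_ _ H _ _] := wprojP; apply: H. Qed.
Lemma wproj_id a x : weight_vector a x -> wproj a x = x.
Proof. by have [_ _ _ H _] := wprojP; apply: H. Qed.
Lemma wproj_sum x : x = \sum_(a <- wts) wproj a x.
Proof. by have [_ _ _ _ H] := wprojP; apply: H. Qed.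

Lemma wproj_ne a b x : weight_vector b x -> a != b -> wproj a x = 0.
Proof.
move=> bx ab; apply: (weight_uniq (wprojV a x) _ ab).
by apply: (weight_line bx); apply: wproj_in (memv_line x); apply: hstable_line bx.
Qed.

Lemma weight_in_wts a x : weight_vector a x -> x != 0 -> a \in wts.
Proof.
move=> ax; apply: contraR => aw; rewrite [x]wproj_sum big1_seq // => b /andP[_ bw].
by apply: wproj_ne ax _; apply: contraNneq aw => <-.
Qed.

Lemma hstable_witness U V : hstable U -> ~~ (U <= V)%VS ->
  exists a v, [/\ weight_vector a v, v \in U & v \notin V].
Proof.
move=> hU /subvPn[x xU xV]; apply: contrapT => H; case/negP: xV.
rewrite [x]wproj_sum rpred_sum // => a _; apply: contrapT => /negP aV; apply: H.
by exists a, (wproj a x); split=> //; [apply: wprojV|apply: wproj_in].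
Qed.

Lemma weight_bracket a b x y : weight_vector a x -> weight_vector b y ->
  weight_vector (a + b) (bracket x y).
Proof.
by move=> ax bx t; rewrite bracket_leibniz ax bx bracketZl linearZ add_lfunE scalerDl.
Qed.

Lemma weight_iter a b x y k : weight_vector a x -> weight_vector b y ->
  weight_vector (b + a *+ k) (iter k (bracket x) y).
Proof.
move=> ax bY; elim: k => [|k IH] /=; first by rewrite mulr0n addr0.
have -> : b + a *+ k.+1 = a + (b + a *+ k) by rewrite mulrS addrCA.
exact: weight_bracket.
Qed.

Lemma weight0_cartan x : weight_vector (0 : weight h) x <-> x \in h.
Proof.
split=> [x0|xh t].
  by apply: cartan_self => t; rewrite x0 zero_lfunE scale0r.
by rewrite cartan_comm ?subvsP // zero_lfunE scale0r.
Qed.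

(** The weights b, b + a, b + 2a, ... are distinct, and g has finitely many. *)
Lemma weight_nilp a x : a != 0 -> weight_vector a x -> ad_nilpotent x.
Proof.
move=> a0 ax; exists (size wts) => y.
rewrite [y]wproj_sum.
have -> m (I : eqType) (r : seq I) E : iter m (bracket x) (\sum_(i <- r) E i) =
    \sum_(i <- r) iter m (bracket x) (E i).
  by elim: m => //= m ->; rewrite linear_sum.
rewrite big1 // => b _; have bw := wprojV b y; set v := wproj b y in bw *.
apply: contrapT => /eqP v0.
have all0 k : (k <= size wts)%N -> iter k (bracket x) v != 0.
  move=> kw; apply: contra_neq v0; rewrite -(subnK kw) iterD => ->.
  exact: iter_bracket0.
pose f k := b + a *+ k.
have finj : injective f.
  move=> k l /addrI; rewrite -(scaler_nat k a) -(scaler_nat l a) => /eqP; rewrite -subr_eq0 -scalerBl.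
  by rewrite scaler_eq0 (negPf a0) orbF subr_eq0 eqr_nat => /eqP.
have : (size [seq f k | k <- iota 0 (size wts).+1] <= size wts)%N.
  apply: uniq_leq_size; first by rewrite map_inj_uniq ?iota_uniq.
  move=> _ /mapP[k + ->]; rewrite mem_iota add0n ltnS => /andP[_ kw].
  exact: weight_in_wts (weight_iter k ax bw) (all0 k kw).
by rewrite size_map size_iota ltnn.
Qed.

End Weights.

(** * Engel's theorem for subalgebras stable under the Cartan subalgebra *)

Section Engel.
Variables (R : realType) (g : lieAlgebra R[i]) (h : {vspace g}).
Hypothesis h_cartan : cartan h.
Implicit Types (A B U V : {vspace g}) (a b : weight h) (x y z : g).

Lemma bracketv_in U V W x y :
  (bracketv U V <= W)%VS -> x \in U -> y \in V -> bracket x y \in W.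
Proof. by move=> /subvP UVW xU yV; apply/UVW/bracketv_sub. Qed.

Lemma hstable_bracketv U V : hstable h U -> hstable h V -> hstable h (bracketv U V).
Proof.
move=> hU hV t x xUV.
suff : (bracketv U V <= linfun (bracket (vsval t)) @^-1: bracketv U V)%VS.
  by move/subvP => /(_ x xUV); rewrite -memv_preim lfunE.
apply: bracketv_min => u v uU vV; rewrite -memv_preim lfunE /=.
by rewrite bracket_leibniz; apply: rpredD; apply: bracketv_sub => //; [apply: hU|apply: hV].
Qed.

Lemma hstable_add U V : hstable h U -> hstable h V -> hstable h (U + V).
Proof.
move=> hU hV t _ /memv_addP[u uU [v vV ->]]; rewrite linearD.
by apply: memv_add; [apply: hU|apply: hV].
Qed.

(** Only weight vectors are asked to be ad-nilpotent: this is what can be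
checked on root spaces, and it suffices for Engel's theorem when the subalgebra
is h-stable. *)
Definition homogeneous_nilpotent A :=
  forall a x, weight_vector a x -> x \in A -> ad_nilpotent x.

Lemma maximal_vspace (P : {vspace g} -> Prop) : (exists U, P U) ->
  exists2 U, P U & forall V, P V -> (U <= V)%VS -> V = U.
Proof.
move=> [U0 PU0]; pose Q n := `[< exists U, P U /\ \dim U = n >].
have Q0 : exists n, Q n by exists (\dim U0); apply/asboolP; exists U0.
have Qb n : Q n -> (n <= \dim {:g})%N.
  by move=> /asboolP[U [_ <-]]; rewrite dimvS ?subvf.
case: (ex_maxnP Q0 Qb) => n /asboolP[U [PU dU]] nmax; exists U => // V PV UV.
by apply/esym/eqP; rewrite eqEdim UV dU nmax //; apply/asboolP; exists V.
Qed.

(** Engel's induction on the dimension of A.  For B a maximal proper h-stable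
subalgebra, the case of B acting on A / B provides a weight vector x of A
outside B that normalizes B, so A = B + <x>.  The vectors of U that B sends into
V form, by the case of B acting on U / V, an h-stable subspace strictly larger
than V; it is stable under the nilpotent x, and the last iterate of x outside
V on a weight vector of this subspace is the required vector. *)
Lemma engel A U V : subalgebra A -> hstable h A -> homogeneous_nilpotent A ->
  hstable h U -> hstable h V -> (V <= U)%VS -> ~~ (U <= V)%VS ->
  (bracketv A U <= U)%VS -> (bracketv A V <= V)%VS ->
  exists a v, [/\ weight_vector a v, v \in U, v \notin V &
                  forall x, x \in A -> bracket x v \in V].
Proof.
have [n] := ubnP (\dim A); elim: n => // n IH in A U V * => dA sA hA nA hU hV VU UV AU AV.
have [A0|A0] := eqVneq A 0%VS.
  have [a [v [av vU vV]]] := hstable_witness h_cartan hU UV.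
  exists a, v; split=> // x; rewrite A0 memv0 => /eqP->.
  by rewrite bracket0l mem0v.
pose P B := [/\ subalgebra B, hstable h B, (B <= A)%VS & ~~ (A <= B)%VS].
have [|B [sB hB BA AB] Bmax] := @maximal_vspace P.
  exists 0%VS; split; rewrite ?sub0v ?subv0 //; first by rewrite /subalgebra bracketv0.
  by move=> t x; rewrite memv0 => /eqP->; rewrite linear0 mem0v.
have nB : homogeneous_nilpotent B by move=> a x ax /(subvP BA); apply: nA ax.
have dB : (\dim B < n)%N.
  rewrite -ltnS; apply: leq_trans dA; rewrite ltnS.
  by rewrite (ltn_leqif (dimv_leqif_sup BA)).
have [|//|b [x [bx xA xB Bx]]] := IH B A B dB sB hB nB hA hB BA AB.
  by apply: subv_trans sA; apply: bracketvS.
have AE : A = (B + <[x]>)%VS.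
  apply/esym/eqP; rewrite eqEsubv subv_add BA -memvE xA /=.
  apply: contraNT xB => AB'.
  have -> : B = (B + <[x]>)%VS; last by rewrite memvE addvSr.
  apply/esym/Bmax; rewrite ?addvSl //; split=> //; last by rewrite subv_add BA -memvE.
  - apply: bracketv_min => y z /memv_addP[u1 u1B [_ /vlineP[c ->] ->]].
    move=> /memv_addP[u2 u2B [_ /vlineP[d ->] ->]].
    rewrite bracketDlr !bracketZl !linearZ /= bracketxx !scaler0 addr0 (bracketC x).
    apply: (subvP (addvSl _ _)); rewrite !rpredD ?rpredZ ?rpredN ?Bx //.
    exact: bracketv_in sB _ _.
  - by apply: hstable_add => //; apply: hstable_line bx.
have [|c w1 w2 [P1 P1'] [P2 P2']|W WP] := @vspace_of_predicate _ g
    (fun w => w \in U /\ forall y, y \in B -> bracket y w \in V).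
- by split=> [|y _]; rewrite ?linear0 mem0v.
- split=> [|y yB]; first by rewrite rpredD ?rpredZ.
  by rewrite linearP rpredD ?rpredZ ?P1' ?P2'.
have hW : hstable h W.
  move=> t w /WP[wU wV]; apply/WP; split; first exact: hU.
  move=> y yB; rewrite bracket_leibniz (bracketC y) bracketNl addrC.
  by rewrite rpredB ?hV ?wV ?hB.
have VW : (V <= W)%VS.
  apply/subvP => w wV; apply/WP; split; first exact: (subvP VU).
  by move=> y yB; apply: bracketv_in AV _ wV; apply: (subvP BA).
have WV : ~~ (W <= V)%VS.
  have [||a [v [av vU vV Bv]]] := IH B U V dB sB hB nB hU hV VU UV.
  - by apply: subv_trans AU; apply: bracketvS.
  - by apply: subv_trans AV; apply: bracketvS.
  by apply/subvPn; exists v => //; apply/WP.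
have [a [v [av vW vV]]] := hstable_witness h_cartan hW WV.
have xW w : w \in W -> bracket x w \in W.
  move=> /WP[wU wV]; apply/WP; split; first exact: bracketv_in AU _ _.
  move=> y yB; rewrite bracket_leibniz.
  by rewrite rpredD ?wV ?Bx //; apply: (bracketv_in AV xA); apply: wV.
have vkW k : iter k (bracket x) v \in W by elim: k => //= k; apply: xW.
have [N xN] := nA b x bx xA.
have ex : exists k, iter k (bracket x) v \in V by exists N; rewrite xN mem0v.
case: (ex_minnP ex) => -[|k] kV kmin; first by rewrite (negPf vV) in kV.
exists (a + b *+ k), (iter k (bracket x) v); have [kU kB] := (WP _).1 (vkW k); split=> //.
- exact: weight_iter.
- by apply/negP => /kmin; rewrite ltnn.
- move=> y; rewrite AE => /memv_addP[u uB [_ /vlineP[c ->] ->]].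
  by rewrite bracketDl1 bracketZl rpredD ?kB // rpredZ //; exact: kV.
Qed.

(** For V a maximal proper h-stable A-submodule of A, [engel] gives
A = V + <v> with [A, v] inside V, so [A, A] is inside V. *)
Lemma engel_derived A : subalgebra A -> hstable h A -> homogeneous_nilpotent A ->
  (A <= bracketv A A)%VS -> A = 0%VS.
Proof.
move=> sA hA nA AA; apply: contrapT => /eqP A0.
pose P V := [/\ hstable h V, (V <= A)%VS, ~~ (A <= V)%VS & (bracketv A V <= V)%VS].
have [|V [hV VA AV sV] Vmax] := @maximal_vspace P.
  exists 0%VS; split; rewrite ?sub0v ?subv0 //.
    by move=> t x; rewrite memv0 => /eqP->; rewrite linear0 mem0v.
  by rewrite -subv0; apply: bracketv_min => x y _; rewrite !memv0 => /eqP->; rewrite linear0.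
have [a [v [av vA vV Av]]] := engel sA hA nA hA hV VA AV sA sV.
have AE : A = (V + <[v]>)%VS.
  apply/esym/eqP; rewrite eqEsubv subv_add VA -memvE vA /=.
  apply: contraNT vV => AV'.
  have -> : V = (V + <[v]>)%VS; last by rewrite memvE addvSr.
  apply/esym/Vmax; rewrite ?addvSl //; split=> //; last first.
  - apply: bracketv_min => y z yA /memv_addP[u uV [_ /vlineP[c ->] ->]].
    apply: (subvP (addvSl _ _)); rewrite linearD linearZ /= rpredD ?rpredZ ?Av //.
    exact: bracketv_in sV _ _.
  - by rewrite subv_add VA -memvE.
  - by apply: hstable_add => //; apply: hstable_line av.
case/negP: AV; apply: subv_trans AA _; apply: bracketv_min => y z yA.
rewrite AE => /memv_addP[u uV [_ /vlineP[c ->] ->]].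
by rewrite linearD linearZ /= rpredD ?rpredZ ?Av //; apply: (bracketv_in sV).
Qed.

Lemma engel_solvable A : subalgebra A -> hstable h A -> homogeneous_nilpotent A ->
  solvable A.
Proof.
have [n] := ubnP (\dim A); elim: n => // n IH in A * => dA sA hA nA.
have [A0|A0] := eqVneq A 0%VS; first by exists 0%N; rewrite A0.
have dAA : (\dim (bracketv A A) < n)%N.
  rewrite -ltnS; apply: leq_trans dA; rewrite ltnS.
  rewrite (ltn_leqif (dimv_leqif_sup sA)); apply: contra_neqN A0 => AA.
  exact: engel_derived.
have [||||m mA] := IH (bracketv A A) => //.
- exact: bracketvS.
- exact: hstable_bracketv.
- by move=> a x ax /(subvP sA); apply: nA ax.
by exists m.+1; rewrite /derived_series iterSr.
Qed.

End Engel.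

(** * The Killing form *)

Section Killing.
Variables (F : fieldType) (g : lieAlgebra F).
Implicit Types (x y z : g).

Definition adm x := mxof (vbasis {:g}) (vbasis {:g}) (linfun (bracket x)).
Definition killing x y := \tr (adm x *m adm y).

Lemma admP x y : rVof (vbasis {:g}) (bracket x y) = rVof (vbasis {:g}) y *m adm x.
Proof. by rewrite -(rVof_app _ (vbasisP _)) lfunE. Qed.

Lemma adm_linear c x y : adm (c *: x + y) = c *: adm x + adm y.
Proof.
rewrite /adm; have -> : linfun (bracket (c *: x + y)) =
    c *: linfun (bracket x) + linfun (bracket y).
  by apply/lfunP => z; rewrite add_lfunE scale_lfunE !lfunE /= bracketDl.
by rewrite linearP.
Qed.

Lemma adm_bracket x y : adm (bracket x y) = adm y *m adm x - adm x *m adm y.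
Proof.
have eb := vbasisP {:g}.
rewrite /adm -!mxof_comp // -linearB; congr mxof; apply/lfunP => z.
by rewrite add_lfunE opp_lfunE !comp_lfunE !lfunE /= bracketA.
Qed.

Lemma adm_central x : (forall y, bracket x y = 0) -> adm x = 0.
Proof.
move=> x0; apply/eqP; rewrite /adm mxof_eq0 ?vbasisP //; apply/eqP/lfunP => y.
by rewrite lfunE /= x0 zero_lfunE.
Qed.

Lemma killingC x y : killing x y = killing y x.
Proof. exact: mxtrace_mulC. Qed.

Lemma killing_linear c x y z : killing (c *: x + y) z = c * killing x z + killing y z.
Proof. by rewrite /killing adm_linear mulmxDl -scalemxAl linearP. Qed.

Lemma killing0 z : killing 0 z = 0.
Proof. by rewrite /killing adm_central ?mul0mx ?linear0 // => y; rewrite bracket0l. Qed.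

Lemma killingZr c x z : killing z (c *: x) = c * killing z x.
Proof. by rewrite killingC -[c *: x]addr0 killing_linear killing0 addr0 killingC. Qed.

Lemma killing_sumr I (r : seq I) (E : I -> g) z :
  killing z (\sum_(i <- r) E i) = \sum_(i <- r) killing z (E i).
Proof.
elim: r => [|i r IH]; first by rewrite !big_nil killingC killing0.
by rewrite !big_cons -IH killingC -[E i]scale1r killing_linear mul1r !(killingC z) scale1r.
Qed.

Lemma killing_invariant x y z : killing (bracket x y) z = killing x (bracket y z).
Proof.
rewrite /killing !adm_bracket mulmxBl mulmxBr.
set X := adm x; set Y := adm y; set Z := adm z.
by rewrite !raddfB /= !mulmxA (mxtrace_mulC (Y *m X)) mulmxA (mxtrace_mulC (Z *m Y)) mulmxA.
Qed.

End Killing.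

(** * Existence of sl2-triples *)

Section SL2Triples.
Variables (R : realType) (g : lieAlgebra R[i]) (h : {vspace g}).
Hypothesis h_cartan : cartan h.
Implicit Types (U V : {vspace g}) (a b : weight h) (x y z e f : g) (t : subvs_of h).

Lemma weight_neq0 a : a != 0 -> exists t, a t != 0.
Proof.
move=> a0; apply: contrapT => H; case/eqP: a0; apply/lfunP => t; rewrite zero_lfunE.
by apply: contrapT => /eqP at0; apply: H; exists t.
Qed.

Lemma bracket_opposite a e f : weight_vector a e -> weight_vector (- a) f ->
  exists t, vsval t = bracket e f.
Proof.
move=> ae af; exists (vsproj h (bracket e f)); rewrite vsprojK //.
apply/(weight0_cartan h_cartan); have -> : 0 = a + - a :> weight h by rewrite subrr.
exact: weight_bracket.
Qed.

Lemma central_weights x : (forall b y, weight_vector b y -> bracket x y = 0) ->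
  forall y, bracket x y = 0.
Proof.
move=> H y; rewrite [y](wproj_sum h_cartan) linear_sum big1 // => b _.
by apply: (H b); apply: wprojV.
Qed.

(** The string relation with al = 0: the last nonzero iterate of e on a vector
of weight b is killed by e, and its string under f forces b(t) = 0. *)
Lemma central_bracket a e f t : a != 0 -> weight_vector a e -> weight_vector (- a) f ->
  vsval t = bracket e f -> a t = 0 -> forall x, bracket (vsval t) x = 0.
Proof.
move=> a0 ae af tE at0; apply: central_weights => b v bv.
have [->|v0] := eqVneq v 0; first exact: linear0.
have eN := weight_nilp h_cartan a0 ae.
have na0 : - a != 0 by rewrite oppr_eq0.
have fN := weight_nilp h_cartan na0 af.
have te : bracket (vsval t) e = 0 *: e by rewrite ae at0.
have tf : bracket (vsval t) f = - 0 *: f by rewrite af opp_lfunE at0.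
have [s [es es1]] := nilp_last eN v0.
have tu := iter_weight s te (bv t); set u := iter s _ v in es tu.
rewrite mulr0 addr0 in tu.
have efu : bracket e (bracket f u) = b t *: u.
  by rewrite bracket_leibniz -tE tu -[bracket e u]/(iter s.+1 (bracket e) v) es1 linear0 addr0.
have [k E] := sl2_string (esym tE) tf fN es tu efu.
have : k.+1%:R * b t = 0 by rewrite -natr1 mulrDl mul1r {2}E; ring.
move/eqP; rewrite mulf_eq0 pnatr_eq0 /= => /eqP bt0.
by rewrite bv bt0 scale0r.
Qed.

Definition sl2_triple a e f t :=
  [/\ weight_vector a e, weight_vector (- a) f, vsval t = bracket e f & a t = 2].

Lemma sl2_tripleP a e f t : sl2_triple a e f t ->
  [/\ a != 0, bracket (vsval t) e = 2 *: e, bracket (vsval t) f = - 2 *: f,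
      ad_nilpotent e & ad_nilpotent f].
Proof.
move=> [ae af tE at2].
have a0 : a != 0 by apply/eqP => a0; move/eqP: at2; rewrite a0 zero_lfunE eq_sym pnatr_eq0.
have na0 : - a != 0 by rewrite oppr_eq0.
split=> //; rewrite ?ae ?af ?opp_lfunE ?at2 //.
  exact (weight_nilp h_cartan a0 ae).
exact (weight_nilp h_cartan na0 af).
Qed.

Lemma sl2_triple_integral a e f t b x : sl2_triple a e f t ->
  weight_vector b x -> x != 0 -> exists m : int, b t = m%:~R.
Proof.
move=> S bx x0; have [a0 te tf eN fN] := sl2_tripleP S; have [_ _ tE _] := S.
exact: (sl2_integral (esym tE) te tf eN fN x0 (bx t)).
Qed.

Lemma sl2_triple_scale a e f t : a != 0 -> weight_vector a e -> weight_vector (- a) f ->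
  vsval t = bracket e f -> a t != 0 ->
  exists f' t', sl2_triple a e f' t'.
Proof.
move=> a0 ae af tE at0; exists ((2 / a t) *: f), ((2 / a t) *: t); split=> //.
- by move=> s; rewrite linearZ /= af !scalerA mulrC.
- by rewrite !linearZ /= tE.
- by rewrite linearZ /= -[LHS]/(2 / a t * a t) divfK.
Qed.

(** In a basis of weight vectors, the value of the form at t is the sum of the
squares of the real numbers b(t), over the weights b with multiplicity. *)
Lemma killing_semidefinite t :
  (forall b x, weight_vector b x -> x != 0 -> b t \is Num.real) ->
  killing (vsval t) (vsval t) = 0 -> forall x, bracket (vsval t) x = 0.
Proof.
move=> tR Kt; have [w [v [wv vx]]] := weight_basis h_cartan.
have eb := vbasisP {:g}.
pose P : 'M_(\dim {:g}) := \matrix_i rVof (vbasis {:g}) (v i).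
have Pf : row_full P.
  rewrite -sub1mx; apply/row_subP => i; have [c cE] := vx (vecof (vbasis {:g}) (row i 1%:M)).
  rewrite -[row i _](vecofK eb) cE linear_sum; apply: summx_sub => j _.
  by rewrite linearZ scalemx_sub //= (eq_row_sub j) // rowK.
have Pu : P \in unitmx by rewrite -row_full_unit.
pose D := diag_mx (\row_i w i t).
have PA : P *m adm (vsval t) = D *m P.
  apply/row_matrixP => i; rewrite !row_mul rowK row_diag_mx -scalemxAl -rowE rowK.
  by rewrite -admP wv linearZ /= mxE.
have AE : adm (vsval t) = invmx P *m D *m P by rewrite -mulmxA -PA mulKmx.
have v0 i : v i != 0.
  apply/eqP => vi; have : row i (P *m invmx P) = 0 by rewrite row_mul rowK vi linear0 mul0mx.
  rewrite mulmxV // => /rowP/(_ i); rewrite !mxE eqxx /= => /eqP.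
  by rewrite oner_eq0.
move: Kt; rewrite /killing AE mulmxA mxtrace_mulC !mulmxA mulmxV // mul1mx.
rewrite mulmxK // mulmx_diag mxtrace_diag => Kt.
have wt0 i : w i t = 0.
  have wr j : w j t \is Num.real := tR _ _ (wv j) (v0 j).
  have ge0 j : true -> 0 <= (\row_j ((\row_i0 w i0 t) 0 j * (\row_i0 w i0 t) 0 j)) 0 j.
    by move=> _; rewrite !mxE -expr2 -realEsqr.
  have := psumr_eq0P (fun j _ => ge0 j isT) Kt (i := i) isT.
  by rewrite !mxE => /eqP; rewrite mulf_eq0 orbb => /eqP.
move=> x; have [c ->] := vx x; rewrite linear_sum big1 // => i _.
by rewrite linearZ /= wv wt0 scale0r scaler0.
Qed.

(** If a did not vanish on [e, f], rescaling f would give an sl2-triple whose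
semisimple element lies in the radical of the form and has integral
eigenvalues, one of which is 2. *)
Lemma killing_kernel_central a e f : a != 0 -> weight_vector a e -> weight_vector (- a) f ->
  (forall y, killing e y = 0) -> forall x, bracket (bracket e f) x = 0.
Proof.
move=> a0 ae af Ke; have [t tE] := bracket_opposite ae af; rewrite -tE.
have [at0|at0] := eqVneq (a t) 0; first exact: central_bracket tE at0.
have [e0 x|e0] := eqVneq e 0; first by rewrite tE e0 bracket0l bracket0l.
have [f' [t' S]] := sl2_triple_scale a0 ae af tE at0.
have [_ te _ _ _] := sl2_tripleP S; have [_ _ tE' _] := S.
suff : 2 *: e = 0 by move/eqP; rewrite scaler_eq0 pnatr_eq0 (negPf e0).
rewrite -te; apply: killing_semidefinite => [b y bY y0|]; last first.
  by rewrite {1}tE' killing_invariant Ke.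
by have [m ->] := sl2_triple_integral S bY y0; exact: realz.
Qed.

Hypothesis g_reductive : reductive g.

(** Let J consist of the elements of the Killing radical whose component of
weight 0 is central.  It is an ideal, as the component of weight 0 of [y, x]
is a sum of brackets of opposite weights, central by [killing_kernel_central];
its weight vectors are ad-nilpotent.  So J is solvable, hence central, whereas
h acts on e with the nonzero weight a. *)
Lemma killing_nondegenerate a e : a != 0 -> weight_vector a e ->
  (forall y, killing e y = 0) -> e = 0.
Proof.
move=> a0 ae Ke.
have [||N NP] := @vspace_of_predicate _ g (fun x => forall y, killing x y = 0).
- exact: killing0.
- by move=> c x y Kx Ky z; rewrite killing_linear Kx Ky mulr0 addr0.
have hN : hstable h N.
  by move=> t x /NP Kx; apply/NP => y; rewrite bracketC -scaleN1r -[_ *: _]addr0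
    killing_linear killing0 killing_invariant Kx mulr0 addr0.
have [||J JP] := @vspace_of_predicate _ g
    (fun x => x \in N /\ forall y, bracket (wproj h_cartan 0 x) y = 0).
- by split=> [|y]; rewrite ?mem0v // linear0 bracket0l.
- move=> c x y [xN x0] [yN y0]; split; first by rewrite rpredD ?rpredZ.
  by move=> z; rewrite linearP bracketDl x0 y0 scaler0 addr0.
have idJ : ideal fullv J.
  rewrite /ideal subvf; apply: bracketv_min => y x _ /JP[xN x0].
  rewrite [y](wproj_sum h_cartan) bracket_suml rpred_sum // => b _.
  have bY := wprojV h_cartan b y; set y' := wproj _ b y in bY *.
  apply/JP; split.
    apply/NP => z; rewrite bracketC -scaleN1r -[_ *: _]addr0 killing_linear killing0.
    by rewrite killing_invariant (NP x).1 // mulr0 addr0.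
  move=> z; rewrite [x](wproj_sum h_cartan) !linear_sum /= bracket_suml big1 // => c _.
  have cx := wprojV h_cartan c x.
  have bc := weight_bracket bY cx.
  have [bc0|bc0] := eqVneq 0 (b + c); last first.
    by rewrite (wproj_ne h_cartan bc bc0) bracket0l.
  rewrite (wproj_id h_cartan); last by rewrite bc0.
  have cE : c = - b by apply/eqP; rewrite -addr_eq0 addrC -bc0.
  have [b0|b0] := eqVneq b 0.
    by rewrite cE b0 oppr0 (bracketC y') x0 oppr0 bracket0l.
  have c0 : c != 0 by rewrite cE oppr_eq0.
  have cy : weight_vector (- c) y' by rewrite cE opprK.
  have Kc : forall u, killing (wproj h_cartan c x) u = 0.
    by apply/NP; apply: wproj_in.
  by rewrite (bracketC y') bracketNl (killing_kernel_central c0 cx cy Kc) oppr0.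
have hJ : hstable h J.
  by move=> t x xJ; have /andP[_ H] := idJ; apply: bracketv_in H _ xJ; apply: memvf.
have solJ : solvable J.
  apply: (engel_solvable h_cartan) => //.
    by have /andP[_] := idJ; apply: subv_trans; apply: bracketvS; rewrite ?subvf.
  move=> b x bx xJ; have [b0|b0] := eqVneq b 0; last exact: (weight_nilp h_cartan b0 bx).
  exists 1%N => y /=; have /JP[_ /(_ y)] := xJ.
  by rewrite (wproj_id h_cartan) // -b0.
have eJ : e \in J.
  apply/JP; split; first exact/NP.
  by move=> y; rewrite (wproj_ne h_cartan ae) ?bracket0l // eq_sym.
have [t at0] := weight_neq0 a0.
have : bracket (vsval t) e \in (0 : {vspace g})%VS.
  by rewrite -(g_reductive idJ solJ); apply: bracketv_sub; rewrite ?memvf.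
by rewrite ae memv0 scaler_eq0 (negPf at0) => /eqP.
Qed.

Lemma killing_pairing a e : a != 0 -> weight_vector a e -> e != 0 ->
  exists2 f, weight_vector (- a) f & killing e f != 0.
Proof.
move=> a0 ae e0; apply: contrapT => H; case/eqP: e0.
apply: (killing_nondegenerate a0 ae) => y.
rewrite [y](wproj_sum h_cartan) killing_sumr big1 // => b _.
have bY := wprojV h_cartan b y; set z := wproj _ b y in bY *.
have [ab0|ab0] := eqVneq (a + b) 0.
  apply: contrapT => /eqP K0; apply: H; exists z => //.
  by have -> : - a = b by apply/esym/eqP; rewrite -addr_eq0 addrC ab0.
have [t abt] := weight_neq0 ab0.
have := killing_invariant e (vsval t) z.
rewrite bY bracketC ae -scaleNr killingZr killingC killingZr (killingC z) => /eqP.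
rewrite -subr_eq0 -mulrBl mulf_eq0 => /orP[|/eqP//].
by rewrite -opprD oppr_eq0 => abt0; move: abt; rewrite add_lfunE abt0.
Qed.

(** Take f of weight -a paired with e by the Killing form.  If a vanished on
[e, f], this element would be central, but its Killing product with s in h is
a(s) times that of e and f. *)
Lemma sl2_exists a e : a != 0 -> weight_vector a e -> e != 0 ->
  exists f t, sl2_triple a e f t.
Proof.
move=> a0 ae e0; have [f af Kef] := killing_pairing a0 ae e0.
have [t tE] := bracket_opposite ae af.
apply: (sl2_triple_scale a0 ae af tE); apply: contraNneq Kef => at0.
have [s as0] := weight_neq0 a0; rewrite -(mulrI_eq0 _ (mulfI as0)).
have <- : killing (bracket e f) (vsval s) = a s * killing e f.
  rewrite killing_invariant bracketC af -scaleNr opp_lfunE opprK.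
  by rewrite killingZr.
rewrite -tE /killing adm_central ?mul0mx ?linear0 //.
exact: central_bracket tE at0.
Qed.

End SL2Triples.

(** * Reflections and dominant points *)

Section RootSystem.
Variables (R : realType) (g : lieAlgebra R[i]) (h : {vspace g}).
Hypothesis h_cartan : cartan h.
Hypothesis g_reductive : reductive g.
Implicit Types (U V : {vspace g}) (a b : weight h) (x y z e f : g) (s t : subvs_of h).

(** Subtract from y a multiple of x so that z = y - c x has a([z, f]) = 0.  Then
f x z = -2 z, which the string upwards from z, of eigenvalue 2, forbids. *)
Lemma root_line a x y : a != 0 -> weight_vector a x -> x != 0 -> weight_vector a y ->
  exists c, y = c *: x.
Proof.
move=> a0 ax x0 ay; have [f [t S]] := sl2_exists h_cartan g_reductive a0 ax x0.
have [_ te tf eN fN] := sl2_tripleP h_cartan S; have [_ af tE at2] := S.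
have [s sE] := bracket_opposite h_cartan ay af.
pose c := a s / 2; exists c; apply/eqP; rewrite -subr_eq0; have [//|z0] := boolP (y - c *: x == 0).
pose z := y - c *: x; have az : weight_vector a z.
  by move=> u; rewrite linearB linearZ /= ax ay scalerBr !scalerA mulrC.
have a0' : a (s - c *: t) = 0.
  by rewrite linearB linearZ /= at2 -[X in _ - X]/(c * 2) divfK ?subrr // pnatr_eq0.
have zf : bracket z f = vsval (s - c *: t).
  by rewrite bracketBl bracketZl -sE -tE linearB linearZ.
have fxz : bracket f (bracket x z) = - 2 *: z.
  rewrite bracket_leibniz.
  have -> : bracket x (bracket f z) = 0.
    by rewrite (bracketC f z) zf bracketC bracketNl ax a0' scale0r !oppr0.
  rewrite addr0.
  by rewrite (bracketC f x) -tE bracketNl az at2 scaleNr.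
have tz : bracket (vsval t) z = 2 *: z by rewrite az at2.
have [k] := sl2_string_up (esym tE) te eN z0 tz fxz.
move/eqP; rewrite -subr_eq0 -oppr_eq0 opprB opprK -!natrM -!natrD pnatr_eq0.
by rewrite addnC.
Qed.

Lemma roots_in_mem U a y : roots_in U a -> weight_vector a y -> y \in U.
Proof.
by move=> [a0 [x [xU x0 ax]]] ay; have [c ->] := root_line a0 ax x0 ay; rewrite rpredZ.
Qed.

Lemma roots_inS U V a : (U <= V)%VS -> roots_in U a -> roots_in V a.
Proof. by move=> UV [a0 [x [xU x0 ax]]]; split=> //; exists x; rewrite (subvP UV). Qed.

Definition reflection a t b : weight h := b - b t *: a.

Lemma reflectionE a t b s : reflection a t b s = b s - b t * a s.
Proof. by rewrite add_lfunE opp_lfunE scale_lfunE. Qed.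

Lemma reflectionK a t : a t = 2 -> involutive (reflection a t).
Proof.
move=> at2 b; apply/lfunP => s; rewrite !reflectionE at2; ring.
Qed.

Lemma reflectionN a t b : reflection (- a) (- t) b = reflection a t b.
Proof. by rewrite /reflection scalerN [b (- t)]linearN scaleNr !opprK. Qed.

Lemma sl2_triple_opp a e f t : sl2_triple a e f t -> sl2_triple (- a) f e (- t).
Proof.
move=> [ae af tE at2]; split=> //; first by rewrite opprK.
- by rewrite linearN /= tE (bracketC e) opprK.
- by rewrite opp_lfunE linearN opprK.
Qed.

Lemma coroot_integral a e f t b : sl2_triple a e f t -> roots_in fullv b ->
  exists m : int, b t = m%:~R.
Proof. by move=> S [_ [x [_ x0 bx]]]; apply: sl2_triple_integral S bx x0. Qed.

Lemma coroot_real a e f t b : sl2_triple a e f t -> roots_in fullv b ->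
  b t \is Num.real.
Proof. by move=> S rb; have [m ->] := coroot_integral S rb; apply: realz. Qed.

(** The reflected weight is b + n a with n = - b(t), and it is carried by e^n x,
which is nonzero by [sl2_inj]. *)
Lemma roots_in_reflection U a e f t b : (forall x, x \in U -> bracket e x \in U) ->
  sl2_triple a e f t -> roots_in U b -> b t <= 0 -> roots_in U (reflection a t b).
Proof.
move=> eU S [b0 [x [xU x0 bx]]] bt.
have [a0 te tf eN fN] := sl2_tripleP h_cartan S; have [ae af tE at2] := S.
have [m mE] := sl2_triple_integral h_cartan S bx x0.
have [n nE] : exists n : nat, b t = - n%:R.
  exists `|m|%N; rewrite mE in bt *; rewrite lerz0 in bt.
  by rewrite pmulrn -mulrNz; congr _%:~R; lia.
split.
  apply/eqP => r0; have := reflectionK at2 b; rewrite r0 /reflection zero_lfunE scale0r subr0.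
  by move=> b0'; rewrite -b0' eqxx in b0.
exists (iter n (bracket e) x); split.
- by elim: n {nE} => //= n; apply: eU.
- apply: contraNneq x0 => ex0; apply/eqP.
  by apply: (sl2_inj (esym tE) te tf fN (leqnn n) _ ex0); rewrite bx nE.
have -> : reflection a t b = b + a *+ n.
  by rewrite /reflection nE scaleNr opprK scaler_nat.
exact: weight_iter.
Qed.

Lemma root_reflection a e f t b : sl2_triple a e f t -> roots_in fullv b ->
  roots_in fullv (reflection a t b).
Proof.
move=> S rb; have := coroot_real S rb; rewrite realE => /orP[bt|bt].
  rewrite -reflectionN; apply: roots_in_reflection (sl2_triple_opp S) rb _.
    by move=> x _; apply: memvf.
  by rewrite linearN oppr_le0.
by apply: roots_in_reflection S rb bt => x _; apply: memvf.
Qed.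

Definition root_seq U : seq (weight h) := [seq a <- wts h_cartan | `[< roots_in U a >]].

Lemma root_seqP U a : reflect (roots_in U a) (a \in root_seq U).
Proof.
rewrite mem_filter; apply: (iffP andP) => [[/asboolP//]|ra]; split; first exact/asboolP.
by have [_ [x [_ x0 ax]]] := ra; apply: (weight_in_wts h_cartan) ax x0.
Qed.

Lemma root_seq_uniq U : uniq (root_seq U).
Proof. by rewrite filter_uniq //; have [] := wprojP h_cartan. Qed.

Lemma perm_map_involutive (I : eqType) (f : I -> I) (r : seq I) : uniq r ->
  involutive f -> {in r, forall i, f i \in r} -> perm_eq (map f r) r.
Proof.
move=> ur fK fr; apply: uniq_perm => //; first by rewrite map_inj_uniq //; apply: inv_inj.
by move=> i; apply/mapP/idP => [[j jr ->]|ir]; [apply: fr|exists (f i); rewrite ?fK ?fr].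
Qed.

(** Each root counts once: permuting the roots by a reflection is then enough
for invariance. *)
Definition root_form s t : R[i] := \sum_(b <- root_seq fullv) b s * b t.

Lemma root_formC s t : root_form s t = root_form t s.
Proof. by apply: eq_bigr => b _; rewrite mulrC. Qed.

(** Invariance of the form under the reflection of a, which sends t to -t and
s to s - a(s) t. *)
Lemma root_form_coroot a e f t s : sl2_triple a e f t ->
  2 * root_form t s = a s * root_form t t.
Proof.
move=> S; have [_ _ _ at2] := S.
have E : root_form t s = - root_form t s + a s * root_form t t.
  rewrite {1}/root_form.
  rewrite -(perm_big _ (perm_map_involutive (root_seq_uniq fullv) (reflectionK at2) _)) /=; last first.
    by move=> b /root_seqP rb; apply/root_seqP; apply: root_reflection S rb.
  rewrite big_map /root_form mulr_sumr -sumrN -big_split /=; apply: eq_bigr => b _.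
  by rewrite !reflectionE at2; ring.
by rewrite mulr2n mulrDl mul1r {2}E; ring.
Qed.

Lemma root_form_gt0 a e f t : sl2_triple a e f t -> e != 0 -> 0 < root_form t t.
Proof.
move=> S e0; have [a0 _ _ _ _] := sl2_tripleP h_cartan S; have [ae _ _ at2] := S.
have aD : a \in root_seq fullv by apply/root_seqP; split=> //; exists e; rewrite memvf.
rewrite /root_form (bigD1_seq a) ?root_seq_uniq //= at2.
apply: ltr_wpDr; last by rewrite mulr_gt0 ?ltr0n.
rewrite big_seq_cond; apply: sumr_ge0 => b /andP[/root_seqP rb _].
by rewrite -expr2 -realEsqr; apply: coroot_real S rb.
Qed.

(** The reflection of a changes the sign of b(t).  It permutes the roots b of U
whose reflection is a root of U, so their contribution is zero.  The other ones
have b(t) > 0 by [roots_in_reflection], and a is one of them unless -a is a root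
of U. *)
Lemma root_sum_coroot U a e f t : (forall x, x \in U -> bracket e x \in U) ->
  sl2_triple a e f t -> e \in U -> e != 0 ->
  0 <= \sum_(b <- root_seq U) b t /\
  (~ roots_in U (- a) -> 0 < \sum_(b <- root_seq U) b t).
Proof.
move=> eU S eU' e0; have [a0 _ _ _ _] := sl2_tripleP h_cartan S; have [ae _ _ at2] := S.
pose r := reflection a t; have rK : involutive r := reflectionK at2.
have real_b b : roots_in U b -> b t \is Num.real.
  by move=> rb; apply: coroot_real S (roots_inS (subvf U) rb).
rewrite (bigID (fun b => r b \in root_seq U)) /=.
have -> : \sum_(b <- root_seq U | r b \in root_seq U) b t = 0.
  rewrite -big_filter; set Q := filter _ _.
  have Qr : {in Q, forall b, r b \in Q}.
    move=> b; rewrite mem_filter => /andP[/= rbU bU].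
    by rewrite mem_filter /= rK rbU bU.
  have uQ : uniq Q by rewrite filter_uniq ?root_seq_uniq.
  have E : \sum_(b <- Q) b t = - \sum_(b <- Q) b t.
    rewrite -{1}(perm_big _ (perm_map_involutive uQ (reflectionK at2) Qr)) /= big_map.
    by rewrite -sumrN; apply: eq_bigr => b _; rewrite reflectionE at2; ring.
  have : 2 * (\sum_(b <- Q) b t) = 0 by rewrite mulr2n mulrDl mul1r {2}E subrr.
  by move/eqP; rewrite mulf_eq0 pnatr_eq0 => /eqP.
rewrite add0r.
have pos b : b \in root_seq U -> r b \notin root_seq U -> 0 < b t.
  move=> /root_seqP rb; apply: contraNT; rewrite -real_leNgt ?real0 ?real_b // => bt.
  by apply/root_seqP; apply: roots_in_reflection S rb bt.
split.
  rewrite big_seq_cond; apply: sumr_ge0 => b /andP[bU rbU].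
  exact/ltW/pos.
move=> na; have raU : r a \notin root_seq U.
  apply/negP => /root_seqP; suff -> : r a = - a by [].
  by apply/lfunP => s; rewrite reflectionE at2 opp_lfunE; ring.
have aU : a \in root_seq U by apply/root_seqP; split=> //; exists e.
rewrite -big_filter; set Q := filter _ _.
have aQ : a \in Q by rewrite mem_filter /= raU aU.
have uQ : uniq Q by rewrite filter_uniq ?root_seq_uniq.
rewrite (bigD1_seq a aQ uQ) /=.
apply: ltr_wpDr; last by rewrite at2.
rewrite big_seq_cond; apply: sumr_ge0 => b /andP[+ _].
by rewrite mem_filter => /andP[rb bU]; apply/ltW/pos.
Qed.

Definition coroot a : subvs_of h := xget 0 [set t | exists e f, sl2_triple a e f t]%classic.

Lemma corootP a : roots_in fullv a -> exists e f, sl2_triple a e f (coroot a).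
Proof.
move=> [a0 [e [_ e0 ae]]]; have [f [t S]] := sl2_exists h_cartan g_reductive a0 ae e0.
apply: (@xgetPex _ 0 [set t | exists e f, sl2_triple a e f t]%classic).
by exists t, e, f.
Qed.

Lemma sl2_triple_neq0 a e f t : sl2_triple a e f t -> e != 0.
Proof.
move=> S; have [a0 _ _ _ _] := sl2_tripleP h_cartan S; have [_ _ tE at2] := S.
apply/eqP => e0; move/eqP: at2; have -> : t = 0.
  by apply: (@subvs_inj _ _ h); rewrite tE e0 bracket0l linear0.
by rewrite linear0 eq_sym pnatr_eq0.
Qed.

Lemma coroot_form_gt0 a : roots_in fullv a -> 0 < root_form (coroot a) (coroot a).
Proof. by move=> /corootP[e [f S]]; apply: root_form_gt0 S (sl2_triple_neq0 S). Qed.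

(** By [root_form_coroot], the multiple of the coroot of b occurring here is dual
to b for [root_form]; the sum is therefore dual to the sum of the roots of U. *)
Definition dominant U : subvs_of h :=
  \sum_(b <- root_seq U) (2 / root_form (coroot b) (coroot b)) *: coroot b.

Lemma root_dominant U a : roots_in fullv a ->
  a (dominant U) = 2 / root_form (coroot a) (coroot a) * \sum_(b <- root_seq U) b (coroot a).
Proof.
move=> ra; rewrite /dominant linear_sum mulr_sumr big_seq [RHS]big_seq.
apply: eq_bigr => b /root_seqP rb; rewrite linearZ /=.
have [ea [fa Sa]] := corootP ra.
have rb' := roots_inS (subvf U) rb.
have [eb [fb Sb]] := corootP rb'.
have Ka := root_form_coroot (coroot b) Sa; have Kb := root_form_coroot (coroot a) Sb.
have := coroot_form_gt0 ra; have := coroot_form_gt0 rb'.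
set Kbb := root_form (coroot b) (coroot b) in Kb *; set Kaa := root_form (coroot a) (coroot a) in Ka *.
move=> /gt_eqF/negbT b0 /gt_eqF/negbT a0.
rewrite (root_formC (coroot b) (coroot a)) Ka in Kb.
have cross (p q u w : R[i]) : p != 0 -> q != 0 -> u * p = w * q -> 2 / q * u = 2 / p * w.
  move=> p0 q0 E; have -> : w = u * p / q by rewrite E mulfK.
  by field; rewrite p0 q0.
exact: cross.
Qed.

Lemma root_dominant_sign U a : subalgebra U -> roots_in U a ->
  0 <= a (dominant U) /\ (~ roots_in U (- a) -> 0 < a (dominant U)).
Proof.
move=> sU ra; have ra' := roots_inS (subvf U) ra.
have [e [f S]] := corootP ra'; have e0 := sl2_triple_neq0 S.
have eU : e \in U by apply: roots_in_mem ra _; have [] := S.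
have [|H1 H2] := root_sum_coroot _ S eU e0.
  by move=> x; apply: bracketv_in sU eU.
have K := coroot_form_gt0 ra'; rewrite root_dominant //; split.
  by rewrite mulr_ge0 // divr_ge0 // ltW.
by move=> /H2 H; rewrite mulr_gt0 // divr_gt0.
Qed.

Lemma coroot_is_coroot a : roots_in fullv a -> is_coroot a (coroot a).
Proof. by move=> ra; have [e [f [ae af tE at2]]] := corootP ra; split=> //; exists e, f. Qed.

Lemma dominant_real (hR : set (subvs_of h)) U : root_real_form hR -> hR (dominant U).
Proof.
move=> [[hR0 hRD hRZ _] hRc _]; rewrite /dominant big_seq; apply: big_ind => // b /root_seqP rb.
have rb' := roots_inS (subvf U) rb; have K := coroot_form_gt0 rb'.
have /complex_realP[s ->] : 2 / root_form (coroot b) (coroot b) \is Num.real.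
  by rewrite ger0_real // divr_ge0 // ltW.
by apply: hRZ; apply: hRc; apply: coroot_is_coroot.
Qed.

(** Otherwise an sl2-triple with e in I and f in U would lie in I, and then in
all its derived subalgebras. *)
Lemma solvable_no_sl2 U I a : ideal U I -> solvable I ->
  roots_in I a -> ~ roots_in U (- a).
Proof.
move=> /andP[IU UI] [n In] [a0 [e [eI e0 ae]]] rna.
have [f [t S]] := sl2_exists h_cartan g_reductive a0 ae e0.
have [_ te tf _ _] := sl2_tripleP h_cartan S; have [_ af tE at2] := S.
have fU : f \in U by apply: roots_in_mem rna af.
have tI : vsval t \in I by rewrite tE bracketC rpredN; apply: bracketv_in UI fU eI.
have two : 2 != 0 :> R[i] by rewrite pnatr_eq0.
have scaled (c : R[i]) x V : c != 0 -> c *: x \in V -> x \in V.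
  by move=> c0 cx; rewrite -[x](scalerK c0) rpredZ.
have fI : f \in I.
  apply: (scaled (- 2)); rewrite ?oppr_eq0 // -tf bracketC rpredN.
  exact: bracketv_in UI fU tI.
suff : [/\ e \in derived_series I n, f \in derived_series I n & vsval t \in derived_series I n].
  by rewrite In memv0 (negPf e0) => -[].
elim: n {In} => //= n [en fn tn]; split.
- by apply: (scaled 2) => //; rewrite -te; apply: bracketv_sub.
- by apply: (scaled (- 2)); rewrite ?oppr_eq0 // -tf; apply: bracketv_sub.
- by rewrite tE; apply: bracketv_sub.
Qed.

End RootSystem.

(** * Cells met by a segment *)

Section Cells.
Variables (R : realType) (g : lieAlgebra R[i]) (h : {vspace g}).
Hypothesis g_reductive : reductive g.
Hypothesis h_cartan : cartan h.
Variable hR : set (subvs_of h).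
Hypothesis hR_real : root_real_form hR.
Local Open Scope complex_scope.
Implicit Types (p q : parab h) (a b : weight h) (s t x y z : subvs_of h).

Lemma eventually_all (T : eqType) (r : seq T) (P : T -> R -> Prop) :
  (forall i, i \in r -> exists2 e, 0 < e & forall e', 0 < e' <= e -> P i e') ->
  exists2 e, 0 < e & forall e', 0 < e' <= e -> forall i, i \in r -> P i e'.
Proof.
elim: r => [|i r IH] H; first by exists 1.
have [|e e0 eP] := IH; first by move=> j jr; apply: H; rewrite inE jr orbT.
have [|d d0 dP] := H i; first by rewrite inE eqxx.
exists (Num.min e d) => [|e' /andP[e'0]]; first by rewrite lt_min e0.
rewrite le_min => /andP[e'e e'd] j; rewrite inE => /orP[/eqP->|jr].
  by apply: dP; rewrite e'0.
by apply: eP; rewrite ?e'0.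
Qed.

Lemma sub_parab p : subalgebra p /\ (h <= p)%VS.
Proof. by have /andP[/asboolP[? _] ?] := valP p. Qed.

Lemma hstable_parab p : hstable h p.
Proof.
have [sp hp] := sub_parab p; move=> t x xp; apply: bracketv_in sp _ xp.
exact: subvP hp _ (subvsP t).
Qed.

Lemma root_evaluation_real a x : roots_in fullv a -> hR x -> a x \is Num.real.
Proof. by have [_ _ H] := hR_real; apply: H. Qed.

(** On the affine hull of the cone, the roots vanishing on the cone stay zero,
and the finitely many other ones stay positive near x. *)
Lemma cell_criterion p x : cone hR p x ->
  (forall a, roots_in p a -> a x = 0 -> forall y, cone hR p y -> a y = 0) ->
  cell hR p x.
Proof.
move=> px pz; split=> //; have [hx xge0] := px.
have [[hR0 hRD hRZ _] _ _] := hR_real.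
(* |a v| <= M a times the sup norm of the coordinates of v. *)
pose M a : R[i] :=
  \sum_(j < \dim {: subvs_of h}) `|a (vbasis {: subvs_of h})`_j : R[i]|.
have [|e e0 eP] := @eventually_all _ (root_seq h_cartan p)
    (fun a e => 0 < a x -> e%:C * M a <= a x).
  move=> a /root_seqP ra; have := xge0 a ra.
  have M0 : 0 <= M a by apply: sumr_ge0.
  have /complex_realP[m mE] : M a \is Num.real by rewrite ger0_real.
  have /complex_realP[r rE] := root_evaluation_real (roots_inS (subvf p) ra) hx.
  rewrite mE ler0c in M0; rewrite mE rE ler0c le_eqVlt => /orP[/eqP <-|r0].
    by exists 1 => // e _; rewrite ltxx.
  have m1 : 0 < m + 1 by rewrite ltr_wpDl.
  exists (r / (m + 1)) => [|e /andP[e0 er] _]; first by rewrite divr_gt0.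
  rewrite -rmorphM lecR; rewrite ler_pdivlMr // in er.
  by apply: le_trans er; rewrite ler_pM2l // lerDl.
exists e => // y [n [c [u [cp u1 yE]]]] ye.
have hy : hR y.
  rewrite yE; apply: (big_ind (fun y => hR y)) => // i _.
  by apply: hRZ; have [] := cp i.
split=> // a ra; have ay : a y \is Num.real.
  exact: root_evaluation_real (roots_inS (subvf p) ra) hy.
have := xge0 a ra; rewrite le_eqVlt => /orP[/eqP/esym ax0|ax0].
  rewrite yE linear_sum big1 // => i _; rewrite linearZ /= (pz a ra ax0 (c i)) //.
  exact: scaler0.
have /eP/(_ a) : 0 < e <= e by rewrite e0 lexx.
move=> /(_ (introT (root_seqP h_cartan p a) ra) ax0) eM.
have : `|a (y - x)| <= a x.
  apply: le_trans eM; rewrite [y - x](coord_vbasis (memvf _)) linear_sum mulr_sumr.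
  apply: le_trans (ler_norm_sum _ _ _) _; apply: ler_sum => j _.
  rewrite linearZ /= -[X in `|X|]/(coord (vbasis fullv) j (y - x) * a (vbasis fullv)`_j).
  by rewrite normrM ler_wpM2r // ltW // ye.
rewrite linearB /= => le_ax; have axr : a x \is Num.real by rewrite gtr0_real.
have := real_ler_norm (rpredB axr ay); rewrite distrC => le2.
by have := le_trans le2 le_ax; rewrite lerBlDr lerDl.
Qed.

(** A root of p vanishing at the dominant point has its opposite among the roots
of p, so it vanishes on the cone. *)
Lemma dominant_cell p : cell hR p (dominant h_cartan p).
Proof.
have [sp hp] := sub_parab p.
apply: cell_criterion; first split.
- exact: dominant_real.
- by move=> a ra; have [] := root_dominant_sign h_cartan g_reductive sp ra.
move=> a ra a0 y [hy yge0]; have [_ pos] := root_dominant_sign h_cartan g_reductive sp ra.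
have [rna|/pos] := pselect (roots_in p (- a)); last by rewrite a0 ltxx.
have := yge0 _ rna; rewrite opp_lfunE oppr_ge0 => ay.
by apply/eqP; rewrite eq_le ay yge0.
Qed.

(** Both summands contain the components of their elements of weight a. *)
Lemma roots_in_add (U V : {vspace g}) a : hstable h U -> hstable h V ->
  roots_in (U + V)%VS a -> roots_in U a \/ roots_in V a.
Proof.
move=> hU hV [a0 [x [/memv_addP[u uU [v vV xE]] x0 ax]]].
have xE' : x = wproj h_cartan a u + wproj h_cartan a v.
  by rewrite -{1}(wproj_id h_cartan ax) xE linearD.
have [u0|u0] := eqVneq (wproj h_cartan a u) 0.
  right; split=> //; exists (wproj h_cartan a v); split.
  - exact: wproj_in.
  - by move: x0; rewrite xE' u0 add0r.
  - exact: wprojV.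
by left; split=> //; exists (wproj h_cartan a u); split=> //; [apply: wproj_in|apply: wprojV].
Qed.

Lemma radical_parab p : ideal p (radical p) /\ solvable (radical p).
Proof. by have [] := radicalP p. Qed.

Lemma dominant_nilpotent_radical p a : roots_in (nilpotent_radical p) a ->
  0 < a (dominant h_cartan p).
Proof.
move=> ra; have [sp hp] := sub_parab p; have [idr solr] := radical_parab p.
have rr : roots_in (radical p) a by apply: roots_inS ra; apply: capvSr.
have rp : roots_in p a by apply: roots_inS rr; have /andP[] := idr.
have [_] := root_dominant_sign h_cartan g_reductive sp rp; apply.
exact: solvable_no_sl2 idr solr rr.
Qed.

Lemma hstable_nilpotent_radical p : hstable h (nilpotent_radical p).
Proof.
have [sp hp] := sub_parab p; have [/andP[_ idr] _] := radical_parab p.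
move=> t x; rewrite !memv_cap => /andP[x1 x2]; apply/andP; split.
  by apply: hstable_bracketv x1 => //; apply: hstable_parab.
by apply: bracketv_in idr _ x2; apply: subvP hp _ (subvsP t).
Qed.

(** The value e = 0 occurs only for the default value p of the Tits product.
The bound 1/2 lets the points obtained from p and from q be put in order on the
segment. *)
Lemma tits_cell p q : exists2 e : R, 0 <= e <= 1 / 2 &
  cell hR (tits p q)
    ((1 - e)%:C *: dominant h_cartan p + e%:C *: dominant h_cartan q).
Proof.
have [sp hp] := sub_parab p; have [sq hq] := sub_parab q.
set x := dominant h_cartan p; set y := dominant h_cartan q.
have hx : hR x by apply: dominant_real.
have hy : hR y by apply: dominant_real.
pose U := ((p :&: q) + nilpotent_radical p)%VS.
have := val_insubd p U; rewrite -/(tits p q); case: ifP => _ titsE; last first.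
  exists 0; first by rewrite lexx divr_ge0.
  have -> : tits p q = p by apply: val_inj.
  by rewrite subr0 scale1r scale0r addr0; apply: dominant_cell.
have {}titsE : tits p q = U :> {vspace g} by [].
have [|e e0 eP] := @eventually_all _ (root_seq h_cartan (nilpotent_radical p))
    (fun a e => 0 < (1 - e)%:C * (a x : R[i]) + e%:C * a y).
  move=> a /root_seqP ra; have ax0 := dominant_nilpotent_radical ra.
  have /complex_realP[r rE] : (a x : R[i]) \is Num.real by rewrite gtr0_real.
  have /complex_realP[u uE] := root_evaluation_real (roots_inS (subvf _) ra) hy.
  rewrite -/x rE in ax0 *; rewrite uE.
  have r0 : 0 < r by rewrite -ltcR.
  have ru : 0 < r + `|u| by rewrite ltr_wpDr.
  (* (1 - e) r + e u >= r - e (r + |u|) >= r / 2 *)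
  exists (r / (2 * (r + `|u|))) => [|e /andP[e0]].
    by rewrite divr_gt0 // mulr_gt0.
  rewrite ler_pdivlMr ?mulr_gt0 // => er.
  rewrite -!rmorphM -rmorphD ltcR.
  have : - `|u| <= u by rewrite lerNl -normrN ler_norm.
  by nra.
pose e' := Num.min e (1 / 2).
have e'0 : 0 < e' by rewrite lt_min e0 divr_gt0.
have e'h : e' <= 1 / 2 by rewrite ge_min lexx orbT.
have e'e : e' <= e by rewrite ge_min lexx.
exists e'; first by rewrite e'h ltW.
set z := _ + _.
have zE a : a z = (1 - e')%:C * (a x : R[i]) + e'%:C * a y :> R[i].
  by rewrite /z linearD !linearZ.
have hz : hR z.
  by have [[_ hRD hRZ _] _ _] := hR_real; apply: hRD; apply: hRZ.
have c1 : 0 < (1 - e')%:C :> R[i] by rewrite ltcR; lra.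
have c2 : 0 < e'%:C :> R[i] by rewrite ltcR.
have cases a : roots_in (tits p q) a ->
    0 < (a z : R[i]) \/ [/\ roots_in p a, roots_in q a & 0 <= (a z : R[i])].
  rewrite titsE => /roots_in_add-[||ra|ra].
  - by move=> t v; rewrite !memv_cap => /andP[vp vq]; rewrite !hstable_parab.
  - exact: hstable_nilpotent_radical.
  - have rp : roots_in p a by apply: roots_inS ra; apply: capvSl.
    have rq : roots_in q a by apply: roots_inS ra; apply: capvSr.
    right; split=> //; rewrite zE addr_ge0 // mulr_ge0 ?(ltW c1) ?(ltW c2) //.
      by have [] := root_dominant_sign h_cartan g_reductive sp rp.
    by have [] := root_dominant_sign h_cartan g_reductive sq rq.
  - left; rewrite zE; apply: eP; first by rewrite e'0.
    exact/root_seqP.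
apply: cell_criterion; first split=> //.
  by move=> a /cases[/ltW|[]].
move=> a ra az0 v [hv vge0]; case: (cases a ra) => [|[rp rq _]].
  by rewrite az0 ltxx.
have [xa0 xpos] := root_dominant_sign h_cartan g_reductive sp rp.
have [ya0 ypos] := root_dominant_sign h_cartan g_reductive sq rq.
move/eqP: az0; rewrite zE paddr_eq0 ?mulr_ge0 ?(ltW c1) ?(ltW c2) //.
rewrite !mulf_eq0 !(gt_eqF c1, gt_eqF c2) /= => /andP[/eqP ax0 /eqP ay0].
have rnp : roots_in p (- a).
  by apply: contrapT => /xpos; rewrite -/x ax0 ltxx.
have rnq : roots_in q (- a).
  by apply: contrapT => /ypos; rewrite -/y ay0 ltxx.
have rna : roots_in (tits p q) (- a).
  have [na0 [w [wp w0 aw]]] := rnp.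
  rewrite titsE; split=> //; exists w; split=> //.
  apply: (subvP (addvSl _ _)); rewrite memv_cap wp.
  exact: roots_in_mem rnq aw.
have := vge0 _ rna; rewrite opp_lfunE oppr_ge0 => av.
by apply/eqP; rewrite eq_le av vge0.
Qed.

(** The two points given by [tits_cell] for (p, q) and (q, p) lie in this order
on the segment between the dominant points, each on its own half. *)
Lemma tits_collinear p q :
  collinear hR p (tits p q) q /\ collinear hR (tits p q) (tits q p) q.
Proof.
have [e /andP[e0 e1] ez] := tits_cell p q; have [d /andP[d0 d1] dz] := tits_cell q p.
have cp := dominant_cell p; have cq := dominant_cell q.
set x := dominant h_cartan p in ez dz cp *; set y := dominant h_cartan q in ez dz cq *.
split.
  exists x, ((1 - e)%:C *: x + e%:C *: y), y; split=> //.
  by exists e => //; rewrite e0; lra.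
exists ((1 - e)%:C *: x + e%:C *: y), ((1 - d)%:C *: y + d%:C *: x), y; split=> //.
have e2 : 0 < 1 - e by lra.
(* The position of the second point between the first one and y. *)
exists (1 - d / (1 - e)).
  rewrite subr_ge0 ler_pdivrMr // mul1r; apply/andP; split; first lra.
  by rewrite lerBlDr lerDl divr_ge0 // ltW.
rewrite scalerDr !scalerA -addrA -scalerDl addrC -!rmorphM -rmorphD.
have -> : (1 - (1 - d / (1 - e))) * (1 - e) = d by field; lra.
have -> : (1 - (1 - d / (1 - e))) * e + (1 - d / (1 - e)) = 1 - d by field; lra.
by [].
Qed.

End Cells.

(** * Transition morphisms *)

Section DoubleIncidenceCategory.
Variables (k : fieldType) (R : realType) (g : lieAlgebra R[i]).
Variables (h : {vspace g}) (hR : set (subvs_of h)).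
Implicit Types p q : parab h.

Lemma Ind_tau p q (pq : (p <= q)%VS) : Ind k hR pq = tau k hR p q.
Proof.
rewrite -(tauE k hR pq (subvv q)).
have -> : Res k hR (subvv q) = idm (l := doubleIncidence k hR) q.
  by apply/qclsP; apply: teq_Res1.
by rewrite comp1m.
Qed.

Lemma Res_tau p q (pq : (p <= q)%VS) : Res k hR pq = tau k hR q p.
Proof.
rewrite -(tauE k hR (subvv q) pq).
have -> : Ind k hR (subvv q) = idm (l := doubleIncidence k hR) q.
  by apply/qclsP; apply: teq_Ind1.
by rewrite compm1.
Qed.

End DoubleIncidenceCategory.

Theorem proposition4p3p3 (k : fieldType) (k_char0 : [pchar k] =i pred0)
    (R : realType) (g : lieAlgebra R[i]) (g_reductive : reductive g)
    (h : {vspace g}) (h_cartan : cartan h)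
    (hR : set (subvs_of h)) (hR_real : root_real_form hR)
    (p1 p p2 : parab h) (p1p : (p1 <= p)%VS) (p2p : (p2 <= p)%VS) :
  Res k hR p2p \oQ Ind k hR p1p
  = Ind k hR (tits_sub p2 p1)
      \oQ tau k hR (tits p1 p2) (tits p2 p1)
      \oQ Res k hR (tits_sub p1 p2).
Proof.
have [col12 col21] := tits_collinear g_reductive h_cartan hR_real p1 p2.
by rewrite tauE Ind_tau Res_tau (tau_collinear k col12) (tau_collinear k col21).
Qed.
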